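(* Let $0<q<1$ and $N,M\in\mathbb Z$. The tensor product connection $\nabla_N^{\bar\partial}\otimes1+(\sigma\otimes1)(1\otimes\nabla_M^{\bar\partial})$ on $\mathcal L_N\otimes_{\mathcal A(\mathbb CP^2_q)}\mathcal L_M$, where $\sigma=\sigma_N:\mathcal L_N\otimes_{\mathcal A(\mathbb CP^2_q)}\Omega^{(0,1)}\to\Omega^{(0,1)}\otimes_{\mathcal A(\mathbb CP^2_q)}\mathcal L_N$ is the twist isomorphism, coincides with the holomorphic structure $\nabla_{N+M}^{\bar\partial}$ when $\mathcal L_N\otimes_{\mathcal A(\mathbb CP^2_q)}\mathcal L_M$ is identified with $\mathcal L_{N+M}$ via multiplication.
   Context: Fix $0<q<1$; $[z]=\frac{q^z-q^{-z}}{q-q^{-1}}$, $[n]!=[1][2]\cdots[n]$, $[j,k,l]!=q^{-(jk+kl+lj)}\frac{[j+k+l]!}{[j]!\,[k]!\,[l]!}$. $U_q(\mathfrak{su}(3))$ is the Hopf $*$-algebra generated by $K_i^{\pm1},E_i,F_i$ ($i=1,2$), $K_i^*=K_i$, $E_i^*=F_i$, with $[K_1,K_2]=0$, $K_iE_i=qE_iK_i$, $[E_i,F_i]=\frac{K_i^2-K_i^{-2}}{q-q^{-1}}$, and for $i\ne j$: $K_iE_j=q^{-1/2}E_jK_i$, $[E_i,F_j]=0$, $E_i^2E_j+E_jE_i^2=(q+q^{-1})E_iE_jE_i$; $\Delta(K_i)=K_i\otimes K_i$, $\Delta(E_i)=E_i\otimes K_i+K_i^{-1}\otimes E_i$, $\Delta(F_i)=F_i\otimes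 K_i+K_i^{-1}\otimes F_i$; $\epsilon(K_i)=1$, $\epsilon(E_i)=\epsilon(F_i)=0$; $S(K_i)=K_i^{-1}$, $S(E_i)=-qE_i$, $S(F_i)=-q^{-1}F_i$. $\mathcal A(SU_q(3))$ is the $*$-algebra generated by $u^i_j$ ($i,j=1,2,3$) with $u^i_ku^j_k=qu^j_ku^i_k$ and $u^k_iu^k_j=qu^k_ju^k_i$ for $i<j$; $[u^i_l,u^j_k]=0$ and $[u^i_k,u^j_l]=(q-q^{-1})u^i_lu^j_k$ for $i<j$, $k<l$; $\sum_{\pi\in S_3}(-q)^{\ell(\pi)}u^1_{\pi(1)}u^2_{\pi(2)}u^3_{\pi(3)}=1$; and $(u^i_j)^*=(-q)^{j-i}(u^{k_1}_{l_1}u^{k_2}_{l_2}-qu^{k_1}_{l_2}u^{k_2}_{l_1})$, where $\{k_1<k_2\}=\{1,2,3\}\setminus\{i\}$, $\{l_1<l_2\}=\{1,2,3\}\setminus\{j\}$. It carries a right action of $U_q(\mathfrak{su}(3))$ with $(ab)\triangleleft h=(a\triangleleft h_{(1)})(b\triangleleft h_{(2)})$, $1\triangleleft h=\epsilon(h)1$, $(a\triangleleft h)^*=a^*\triangleleft S(h)^*$, and $u^j_k\triangleleft K_i=q^{\frac12(\delta_{i+1,j}-\delta_{i,j})}u^j_k$, $u^j_k\triangleleft E_i=\delta_{i+1,j}u^i_k$, $u^j_k\triangleleft F_i=\delta_{i,j}u^{i+1}_k$. Let $U_q(\mathfrak{su}(2))$ be the subalgebra generated by $K_1^{\pm1},E_1,F_1$.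 Put $\mathcal A(S^5_q)=\{a\in\mathcal A(SU_q(3)): a\triangleleft h=\epsilon(h)a\ \forall h\in U_q(\mathfrak{su}(2))\}$, generated as a $*$-algebra by $z_j=u^3_j$; for $N\in\mathbb Z$, $\mathcal L_N=\{a\in\mathcal A(S^5_q): a\triangleleft K_1K_2^2=q^Na\}$; and $\mathcal A(\mathbb CP^2_q)=\mathcal L_0$. Each $\mathcal L_N$ is an $\mathcal A(\mathbb CP^2_q)$-bimodule by multiplication, and multiplication induces $\mathcal L_N\otimes_{\mathcal A(\mathbb CP^2_q)}\mathcal L_M\simeq\mathcal L_{N+M}$. $\Omega^{(0,1)}$ is the set of pairs $(v_+,v_-)^t\in\mathcal A(SU_q(3))^2$ such that (componentwise action) $(v_+,v_-)\triangleleft K_1K_2^2=q^{3/2}(v_+,v_-)$, $(v_+,v_-)\triangleleft K_1=(q^{1/2}v_+,q^{-1/2}v_-)$, $(v_+,v_-)\triangleleft F_1=(0,v_+)$, $(v_+,v_-)\triangleleft E_1=(v_-,0)$; it is an $\mathcal A(\mathbb CP^2_q)$-bimodule by componentwise multiplication. $\bar\partial:\mathcal A(\mathbb CP^2_q)\to\Omega^{(0,1)}$ is $\bar\partial a=(a\triangleleft F_2F_1,\ a\triangleleft F_2)^t$. $\Psi_N$ is the column vector with components $\psi^N_{j,k,l}$ ($j,k,l\ge0$, $j+k+l=|N|$), where $(\psi^N_{j,k,l})^*=\sqrt{[j,k,l]!}\,z_1^jz_2^kz_3^l$ if $N\ge0$ and $(\psi^N_{j,k,l})^*=q^{-N+j-l}\sqrt{[j,k,l]!}\,(z_1^jz_2^kz_3^l)^*$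 if $N\le 0$; then $\Psi_N^\dagger\Psi_N=1$. For $\xi\in\mathcal L_N$ the entries of $\Psi_N\xi$ are in $\mathcal A(\mathbb CP^2_q)$. The multiplication map $\Omega^{(0,1)}\otimes_{\mathcal A(\mathbb CP^2_q)}\mathcal L_N\to\mathcal A(SU_q(3))^2$, $(v_+,v_-)^t\otimes\xi\mapsto(v_+\xi,v_-\xi)^t$, is injective and identifies $\Omega^{(0,1)}\otimes\mathcal L_N$ with its image. The $\bar\partial$-connection (holomorphic structure) is $\nabla_N^{\bar\partial}:\mathcal L_N\to\Omega^{(0,1)}\otimes_{\mathcal A(\mathbb CP^2_q)}\mathcal L_N$, $\nabla_N^{\bar\partial}\xi=q^{-N}\Psi_N^\dagger\,\bar\partial(\Psi_N\xi)=q^{-N}\Psi_N^\dagger\big((\Psi_N\xi)\triangleleft F_2F_1,\ (\Psi_N\xi)\triangleleft F_2\big)^t$. Twist: let $\phi_1:\Omega^{(0,1)}\otimes_{\mathcal A(\mathbb CP^2_q)}\mathcal L_N\to\mathcal A(SU_q(3))^2$, $\phi_1((v_+,v_-)^t\otimes\xi)=q^{N/2}(v_+\xi,v_-\xi)^t$, and $\phi_2:\mathcal L_N\otimes_{\mathcal A(\mathbb CP^2_q)}\Omega^{(0,1)}\to\mathcal A(SU_q(3))^2$, $\phi_2(\xi\otimes(v_+,v_-)^t)=q^{-N/2}(\xi v_+,\xi v_-)^t$. Both are injective with the same image, and $\sigma_N:=\phi_1^{-1}\phi_2:\mathcal L_N\otimes\Omega^{(0,1)}\to\Omega^{(0,1)}\otimes\mathcal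 L_N$ is a bimodule isomorphism; equivalently $\sigma_N(\xi\otimes\omega)=q^{-N}\sum\omega'\otimes\xi'$ where $\sum\omega'\xi'=\xi\omega$ in $\mathcal A(SU_q(3))^2$. *)

(* Defs.v *)
From HB Require Import structures.
From mathcomp Require Import all_boot all_order all_algebra perm.
From mathcomp Require Import generic_quotient.
From mathcomp Require Import boolp classical_sets reals complex.

Set Implicit Arguments.
Unset Strict Implicit.
Unset Printing Implicit Defensive.

Import Order.TTheory GRing.Theory Num.Theory.

Local Open Scope ring_scope.
Local Open Scope quotient_scope.

(******************************************************************************)
(* Unital *-algebras over C presented by generators G and relations rel:      *)
(* formal *-algebra expressions modulo the least congruence containing rel    *)
(* and the axioms of an associative unital *-algebra.                         *)
(******************************************************************************)

Section Presentation.
Variables (C : numClosedFieldType) (G : Type).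

Inductive sterm :=
  | TGen of G
  | TZero
  | TOne
  | TAdd of sterm & sterm
  | TMul of sterm & sterm
  | TScale of C & sterm
  | TStar of sterm.

HB.instance Definition _ := gen_eqMixin sterm.
HB.instance Definition _ := gen_choiceMixin sterm.

Definition TSub (s t : sterm) : sterm := TAdd s (TScale (-1) t).

Variable rel : sterm -> sterm -> Prop.

Inductive scongr : sterm -> sterm -> Prop :=
  | scongr_rel s t : rel s t -> scongr s t
  | scongr_refl s : scongr s s
  | scongr_sym s t : scongr s t -> scongr t s
  | scongr_trans s t u : scongr s t -> scongr t u -> scongr s u
  | scongr_add s s' t t' :
      scongr s s' -> scongr t t' -> scongr (TAdd s t) (TAdd s' t')
  | scongr_mul s s' t t' :
      scongr s s' -> scongr t t' -> scongr (TMul s t) (TMul s' t')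
  | scongr_scale c s s' : scongr s s' -> scongr (TScale c s) (TScale c s')
  | scongr_star s s' : scongr s s' -> scongr (TStar s) (TStar s')
  | scongr_addA s t u : scongr (TAdd s (TAdd t u)) (TAdd (TAdd s t) u)
  | scongr_addC s t : scongr (TAdd s t) (TAdd t s)
  | scongr_add0 s : scongr (TAdd TZero s) s
  | scongr_mulA s t u : scongr (TMul s (TMul t u)) (TMul (TMul s t) u)
  | scongr_mul1l s : scongr (TMul TOne s) s
  | scongr_mul1r s : scongr (TMul s TOne) s
  | scongr_mulDl s t u :
      scongr (TMul (TAdd s t) u) (TAdd (TMul s u) (TMul t u))
  | scongr_mulDr s t u :
      scongr (TMul s (TAdd t u)) (TAdd (TMul s t) (TMul s u))
  | scongr_scaleA c d s : scongr (TScale c (TScale d s)) (TScale (c * d) s)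
  | scongr_scale1 s : scongr (TScale 1 s) s
  | scongr_scale0 s : scongr (TScale 0 s) TZero
  | scongr_scaleDl c d s :
      scongr (TScale (c + d) s) (TAdd (TScale c s) (TScale d s))
  | scongr_scaleDr c s t :
      scongr (TScale c (TAdd s t)) (TAdd (TScale c s) (TScale c t))
  | scongr_scaleAl c s t : scongr (TScale c (TMul s t)) (TMul (TScale c s) t)
  | scongr_scaleAr c s t : scongr (TScale c (TMul s t)) (TMul s (TScale c t))
  | scongr_starD s t : scongr (TStar (TAdd s t)) (TAdd (TStar s) (TStar t))
  | scongr_starM s t : scongr (TStar (TMul s t)) (TMul (TStar t) (TStar s))
  | scongr_starZ c s :
      scongr (TStar (TScale c s)) (TScale (Num.conj c) (TStar s))
  | scongr_starK s : scongr (TStar (TStar s)) s.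

Definition scongrb (s t : sterm) : bool := `[< scongr s t >].

Lemma scongrb_refl : reflexive scongrb.
Proof. by move=> s; apply/asboolP; exact: scongr_refl. Qed.

Lemma scongrb_sym : symmetric scongrb.
Proof.
by move=> s t; apply/asboolP/asboolP; exact: scongr_sym.
Qed.

Lemma scongrb_trans : transitive scongrb.
Proof.
by move=> t s u /asboolP st /asboolP tu; apply/asboolP; exact: scongr_trans tu.
Qed.

Canonical scongr_equiv := EquivRel scongrb scongrb_refl scongrb_sym scongrb_trans.

Definition salg := {eq_quot scongrb}.
HB.instance Definition _ := Choice.on salg.
HB.instance Definition _ := EqQuotient.on salg.

Definition scls (s : sterm) : salg := \pi_salg s.

Lemma sclsP s t : scls s = scls t <-> scongr s t.
Proof.
by split=> [/eqquotP /asboolP|st] //; apply/eqquotP/asboolP.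
Qed.

Lemma repr_scls s : scongr (repr (scls s)) s.
Proof. by apply/sclsP; rewrite /scls reprK. Qed.

Lemma scls_repr x : scls (repr x) = x.
Proof. by rewrite /scls reprK. Qed.

Definition salg_zero : salg := scls TZero.
Definition salg_one : salg := scls TOne.
Definition salg_add (x y : salg) : salg := scls (TAdd (repr x) (repr y)).
Definition salg_opp (x : salg) : salg := scls (TScale (-1) (repr x)).
Definition salg_mul (x y : salg) : salg := scls (TMul (repr x) (repr y)).
Definition salg_scale (c : C) (x : salg) : salg := scls (TScale c (repr x)).
Definition star (x : salg) : salg := scls (TStar (repr x)).

Lemma salg_addE s t : salg_add (scls s) (scls t) = scls (TAdd s t).
Proof. by apply/sclsP; apply: scongr_add; exact: repr_scls. Qed.
Lemma salg_oppE s : salg_opp (scls s) = scls (TScale (-1) s).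
Proof. by apply/sclsP; apply: scongr_scale; exact: repr_scls. Qed.
Lemma salg_mulE s t : salg_mul (scls s) (scls t) = scls (TMul s t).
Proof. by apply/sclsP; apply: scongr_mul; exact: repr_scls. Qed.
Lemma salg_scaleE c s : salg_scale c (scls s) = scls (TScale c s).
Proof. by apply/sclsP; apply: scongr_scale; exact: repr_scls. Qed.
Lemma scls_star s : star (scls s) = scls (TStar s).
Proof. by apply/sclsP; apply: scongr_star; exact: repr_scls. Qed.

Lemma salg_ind (P : salg -> Prop) : (forall s, P (scls s)) -> forall x, P x.
Proof. by move=> H x; rewrite -(scls_repr x). Qed.

Let salgE := (salg_addE, salg_oppE, salg_mulE, salg_scaleE).

Lemma salg_addA : associative salg_add.
Proof.
elim/salg_ind=> s; elim/salg_ind=> t; elim/salg_ind=> u; rewrite !salgE.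
by apply/sclsP; exact: scongr_addA.
Qed.
Lemma salg_addC : commutative salg_add.
Proof.
elim/salg_ind=> s; elim/salg_ind=> t; rewrite !salgE.
by apply/sclsP; exact: scongr_addC.
Qed.
Lemma salg_add0 : left_id salg_zero salg_add.
Proof. by elim/salg_ind=> s; rewrite !salgE; apply/sclsP; exact: scongr_add0. Qed.
Lemma salg_addN : left_inverse salg_zero salg_opp salg_add.
Proof.
elim/salg_ind=> s; rewrite !salgE; apply/sclsP.
apply: (@scongr_trans _ (TAdd (TScale (-1) s) (TScale 1 s))).
  by apply: scongr_add; [exact: scongr_refl|apply/scongr_sym/scongr_scale1].
apply: scongr_trans (scongr_sym (scongr_scaleDl _ _ _)) _.
by rewrite addNr; exact: scongr_scale0.
Qed.

HB.instance Definition _ := GRing.isZmodule.Build salg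
  salg_addA salg_addC salg_add0 salg_addN.

Lemma sclsD s t : scls (TAdd s t) = scls s + scls t.
Proof. by rewrite -salg_addE. Qed.
Lemma sclsN s : scls (TScale (-1) s) = - scls s.
Proof. by rewrite -salg_oppE. Qed.
Lemma scls0 : scls TZero = 0. Proof. by []. Qed.

Lemma salg_mulA : associative salg_mul.
Proof.
elim/salg_ind=> s; elim/salg_ind=> t; elim/salg_ind=> u; rewrite !salgE.
by apply/sclsP; exact: scongr_mulA.
Qed.
Lemma salg_mul1l : left_id salg_one salg_mul.
Proof. by elim/salg_ind=> s; rewrite !salgE; apply/sclsP; exact: scongr_mul1l. Qed.
Lemma salg_mul1r : right_id salg_one salg_mul.
Proof. by elim/salg_ind=> s; rewrite !salgE; apply/sclsP; exact: scongr_mul1r. Qed.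
Lemma salg_mulDl : left_distributive salg_mul +%R.
Proof.
elim/salg_ind=> s; elim/salg_ind=> t; elim/salg_ind=> u.
rewrite -(sclsD s t) !salgE -(sclsD (TMul s u)).
by apply/sclsP; exact: scongr_mulDl.
Qed.
Lemma salg_mulDr : right_distributive salg_mul +%R.
Proof.
elim/salg_ind=> s; elim/salg_ind=> t; elim/salg_ind=> u.
rewrite -(sclsD t u) !salgE -(sclsD (TMul s t)).
by apply/sclsP; exact: scongr_mulDr.
Qed.

HB.instance Definition _ := GRing.Zmodule_isPzRing.Build salg
  salg_mulA salg_mul1l salg_mul1r salg_mulDl salg_mulDr.

Lemma sclsM s t : scls (TMul s t) = scls s * scls t.
Proof. by rewrite -salg_mulE. Qed.
Lemma scls1 : scls TOne = 1. Proof. by []. Qed.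

Lemma salg_scaleA c d x : salg_scale c (salg_scale d x) = salg_scale (c * d) x.
Proof.
elim/salg_ind: x => s; rewrite !salgE.
by apply/sclsP; exact: scongr_scaleA.
Qed.
Lemma salg_scale1 : left_id 1 salg_scale.
Proof. by elim/salg_ind=> s; rewrite !salgE; apply/sclsP; exact: scongr_scale1. Qed.
Lemma salg_scaleDr : right_distributive salg_scale +%R.
Proof.
move=> c; elim/salg_ind=> s; elim/salg_ind=> t.
rewrite -(sclsD s t) !salgE -(sclsD (TScale c s)).
by apply/sclsP; exact: scongr_scaleDr.
Qed.
Lemma salg_scaleDl x : {morph salg_scale^~ x : c d / c + d}.
Proof.
elim/salg_ind: x => s c d.
rewrite !salgE -(sclsD (TScale c s)).
by apply/sclsP; exact: scongr_scaleDl.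
Qed.

HB.instance Definition _ := GRing.Zmodule_isLmodule.Build C salg
  salg_scaleA salg_scale1 salg_scaleDr salg_scaleDl.

Lemma sclsZ c s : scls (TScale c s) = c *: scls s.
Proof. by rewrite -salg_scaleE. Qed.
Lemma sclsB s t : scls (TSub s t) = scls s - scls t.
Proof. by rewrite /TSub sclsD sclsZ scaleN1r. Qed.

Lemma salg_scaleAl (c : C) (x y : salg) : c *: (x * y) = (c *: x) * y.
Proof.
elim/salg_ind: x => s; elim/salg_ind: y => t.
by rewrite -!(sclsZ, sclsM); apply/sclsP; exact: scongr_scaleAl.
Qed.
Lemma salg_scaleAr (c : C) (x y : salg) : c *: (x * y) = x * (c *: y).
Proof.
elim/salg_ind: x => s; elim/salg_ind: y => t.
by rewrite -!(sclsZ, sclsM); apply/sclsP; exact: scongr_scaleAr.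
Qed.

Lemma starD : {morph star : x y / x + y}.
Proof.
elim/salg_ind=> s; elim/salg_ind=> t.
by rewrite -sclsD !scls_star -sclsD; apply/sclsP; exact: scongr_starD.
Qed.
Lemma starM (x y : salg) : star (x * y) = star y * star x.
Proof.
elim/salg_ind: x => s; elim/salg_ind: y => t.
by rewrite -sclsM !scls_star -sclsM; apply/sclsP; exact: scongr_starM.
Qed.
Lemma starZ (c : C) (x : salg) : star (c *: x) = Num.conj c *: star x.
Proof.
elim/salg_ind: x => s.
by rewrite -sclsZ !scls_star -sclsZ; apply/sclsP; exact: scongr_starZ.
Qed.
Lemma starK : involutive star.
Proof.
elim/salg_ind=> s; rewrite !scls_star.
by apply/sclsP; exact: scongr_starK.
Qed.

Lemma salg_rel s t : rel s t -> scls s = scls t.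
Proof. by move=> st; apply/sclsP; exact: scongr_rel. Qed.

Fixpoint seval (f : G -> C) (s : sterm) : C :=
  match s with
  | TGen g => f g
  | TZero => 0
  | TOne => 1
  | TAdd s t => seval f s + seval f t
  | TMul s t => seval f s * seval f t
  | TScale c s => c * seval f s
  | TStar s => Num.conj (seval f s)
  end.

Definition schar (f : G -> C) (x : salg) : C := seval f (repr x).

Section Character.
Variable f : G -> C.
Hypothesis f_rel : forall s t, rel s t -> seval f s = seval f t.

Lemma seval_congr s t : scongr s t -> seval f s = seval f t.
Proof.
elim=> {s t} //=.
- by move=> s t u _ -> _ ->.
- by move=> s s' t t' _ -> _ ->.
- by move=> s s' t t' _ -> _ ->.
- by move=> c s s' _ ->.
- by move=> s s' _ ->.
- by move=> s t u; rewrite addrA.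
- by move=> s t; rewrite addrC.
- by move=> s; rewrite add0r.
- by move=> s t u; rewrite mulrA.
- by move=> s; rewrite mul1r.
- by move=> s; rewrite mulr1.
- by move=> s t u; rewrite mulrDl.
- by move=> s t u; rewrite mulrDr.
- by move=> c d s; rewrite mulrA.
- by move=> s; rewrite mul1r.
- by move=> s; rewrite mul0r.
- by move=> c d s; rewrite mulrDl.
- by move=> c s t; rewrite mulrDr.
- by move=> c s t; rewrite mulrA.
- by move=> c s t; rewrite mulrCA.
- by move=> s t; rewrite rmorphD.
- by move=> s t; rewrite rmorphM mulrC.
- by move=> c s; rewrite rmorphM.
- by move=> s; rewrite conjCK.
Qed.

Lemma schar_scls s : schar f (scls s) = seval f s.
Proof. by apply: seval_congr; exact: repr_scls. Qed.

Lemma scharD : {morph schar f : x y / x + y}.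
Proof.
by elim/salg_ind=> s; elim/salg_ind=> t; rewrite -sclsD !schar_scls.
Qed.
Lemma scharM : {morph schar f : x y / x * y}.
Proof.
by elim/salg_ind=> s; elim/salg_ind=> t; rewrite -sclsM !schar_scls.
Qed.
Lemma scharZ c x : schar f (c *: x) = c * schar f x.
Proof. by elim/salg_ind: x => s; rewrite -sclsZ !schar_scls. Qed.
Lemma schar1 : schar f 1 = 1.
Proof. by rewrite -scls1 schar_scls. Qed.
Lemma salg_oner_neq0 : (1 : salg) != 0.
Proof.
apply/eqP=> /(congr1 (schar f)); rewrite schar1 -scls0 schar_scls /=.
by move/eqP; rewrite oner_eq0.
Qed.
End Character.

End Presentation.

Declare Scope sterm_scope.
Delimit Scope sterm_scope with T.
Bind Scope sterm_scope with sterm.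
Notation "s + t" := (TAdd s t) : sterm_scope.
Notation "s - t" := (TSub s t) : sterm_scope.
Notation "s * t" := (TMul s t) : sterm_scope.
Notation "c *: s" := (TScale c%R s) : sterm_scope.
Notation "0" := (TZero _ _) : sterm_scope.
Notation "1" := (TOne _ _) : sterm_scope.

Record bimodule (S : pzRingType) := Bimodule {
  bim_sort :> zmodType;
  lact : S -> bim_sort -> bim_sort;
  ract : bim_sort -> S -> bim_sort;
  lactDl : forall a b x, lact (a + b) x = lact a x + lact b x;
  lactDr : forall a x y, lact a (x + y) = lact a x + lact a y;
  lactM : forall a b x, lact (a * b) x = lact a (lact b x);
  lact1 : forall x, lact 1 x = x;
  ractDl : forall x y a, ract (x + y) a = ract x a + ract y a;
  ractDr : forall x a b, ract x (a + b) = ract x a + ract x b;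
  ractM : forall x a b, ract x (a * b) = ract (ract x a) b;
  ract1 : forall x, ract x 1 = x;
  lactA : forall a x b, lact a (ract x b) = ract (lact a x) b
}.

Section Tensor.
Variables (S : pzRingType) (U V : bimodule S).

(* formal sums of pure tensors, modulo the least additive congruence that     *)
(* makes the pure tensors biadditive and S-balanced                           *)
Inductive tterm :=
  | TTZero
  | TTPure of U & V
  | TTAdd of tterm & tterm
  | TTOpp of tterm.

HB.instance Definition _ := gen_eqMixin tterm.
HB.instance Definition _ := gen_choiceMixin tterm.

Inductive tcongr : tterm -> tterm -> Prop :=
  | tcongr_refl s : tcongr s s
  | tcongr_sym s t : tcongr s t -> tcongr t s
  | tcongr_trans s t u : tcongr s t -> tcongr t u -> tcongr s u
  | tcongr_add s s' t t' :
      tcongr s s' -> tcongr t t' -> tcongr (TTAdd s t) (TTAdd s' t')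
  | tcongr_opp s s' : tcongr s s' -> tcongr (TTOpp s) (TTOpp s')
  | tcongr_addA s t u : tcongr (TTAdd s (TTAdd t u)) (TTAdd (TTAdd s t) u)
  | tcongr_addC s t : tcongr (TTAdd s t) (TTAdd t s)
  | tcongr_add0 s : tcongr (TTAdd TTZero s) s
  | tcongr_addN s : tcongr (TTAdd (TTOpp s) s) TTZero
  | tcongr_pureDl x y v :
      tcongr (TTPure (x + y) v) (TTAdd (TTPure x v) (TTPure y v))
  | tcongr_pureDr x v w :
      tcongr (TTPure x (v + w)) (TTAdd (TTPure x v) (TTPure x w))
  | tcongr_balanced x a v : tcongr (TTPure (ract x a) v) (TTPure x (lact a v)).

Definition tcongrb (s t : tterm) : bool := `[< tcongr s t >].

Lemma tcongrb_refl : reflexive tcongrb.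
Proof. by move=> s; apply/asboolP; exact: tcongr_refl. Qed.
Lemma tcongrb_sym : symmetric tcongrb.
Proof. by move=> s t; apply/asboolP/asboolP; exact: tcongr_sym. Qed.
Lemma tcongrb_trans : transitive tcongrb.
Proof.
by move=> t s u /asboolP st /asboolP tu; apply/asboolP; exact: tcongr_trans tu.
Qed.

Canonical tcongr_equiv := EquivRel tcongrb tcongrb_refl tcongrb_sym tcongrb_trans.

Definition tensor_sort := {eq_quot tcongrb}.
HB.instance Definition _ := Choice.on tensor_sort.
HB.instance Definition _ := EqQuotient.on tensor_sort.

Definition tcls (s : tterm) : tensor_sort := \pi_tensor_sort s.

Lemma tclsP s t : tcls s = tcls t <-> tcongr s t.
Proof. by split=> [/eqquotP /asboolP|st] //; apply/eqquotP/asboolP. Qed.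
Lemma repr_tcls s : tcongr (repr (tcls s)) s.
Proof. by apply/tclsP; rewrite /tcls reprK. Qed.
Lemma tcls_repr x : tcls (repr x) = x.
Proof. by rewrite /tcls reprK. Qed.
Lemma tcls_ind (P : tensor_sort -> Prop) :
  (forall s, P (tcls s)) -> forall x, P x.
Proof. by move=> H x; rewrite -(tcls_repr x). Qed.

Definition tensor_zero : tensor_sort := tcls TTZero.
Definition tensor_add (x y : tensor_sort) : tensor_sort :=
  tcls (TTAdd (repr x) (repr y)).
Definition tensor_opp (x : tensor_sort) : tensor_sort := tcls (TTOpp (repr x)).

Lemma tensor_addE s t : tensor_add (tcls s) (tcls t) = tcls (TTAdd s t).
Proof. by apply/tclsP; apply: tcongr_add; exact: repr_tcls. Qed.
Lemma tensor_oppE s : tensor_opp (tcls s) = tcls (TTOpp s).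
Proof. by apply/tclsP; apply: tcongr_opp; exact: repr_tcls. Qed.

Lemma tensor_addA : associative tensor_add.
Proof.
elim/tcls_ind=> s; elim/tcls_ind=> t; elim/tcls_ind=> u.
by rewrite !tensor_addE; apply/tclsP; exact: tcongr_addA.
Qed.
Lemma tensor_addC : commutative tensor_add.
Proof.
elim/tcls_ind=> s; elim/tcls_ind=> t.
by rewrite !tensor_addE; apply/tclsP; exact: tcongr_addC.
Qed.
Lemma tensor_add0 : left_id tensor_zero tensor_add.
Proof.
by elim/tcls_ind=> s; rewrite tensor_addE; apply/tclsP; exact: tcongr_add0.
Qed.
Lemma tensor_addN : left_inverse tensor_zero tensor_opp tensor_add.
Proof.
elim/tcls_ind=> s; rewrite tensor_oppE tensor_addE.
by apply/tclsP; exact: tcongr_addN.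
Qed.

HB.instance Definition _ := GRing.isZmodule.Build tensor_sort
  tensor_addA tensor_addC tensor_add0 tensor_addN.

Definition pure (x : U) (v : V) : tensor_sort := tcls (TTPure x v).

Lemma tclsD s t : tcls (TTAdd s t) = tcls s + tcls t.
Proof. by rewrite -tensor_addE. Qed.
Lemma tclsN s : tcls (TTOpp s) = - tcls s.
Proof. by rewrite -tensor_oppE. Qed.
Lemma tcls0 : tcls TTZero = 0. Proof. by []. Qed.

Lemma pureDl x y v : pure (x + y) v = pure x v + pure y v.
Proof. by rewrite /pure -tclsD; apply/tclsP; exact: tcongr_pureDl. Qed.
Lemma pureDr x v w : pure x (v + w) = pure x v + pure x w.
Proof. by rewrite /pure -tclsD; apply/tclsP; exact: tcongr_pureDr. Qed.
Lemma pure_balanced x a v : pure (ract x a) v = pure x (lact a v).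
Proof. by apply/tclsP; exact: tcongr_balanced. Qed.

Lemma tensor_ind (P : tensor_sort -> Prop) :
  P 0 -> (forall x v, P (pure x v)) ->
  (forall s t, P s -> P t -> P (s + t)) -> (forall s, P s -> P (- s)) ->
  forall t, P t.
Proof.
move=> P0 Pp PD PN; elim/tcls_ind; elim=> [|x v|s IHs t IHt|s IHs].
- exact: P0.
- exact: Pp.
- by rewrite tclsD; exact: PD.
- by rewrite tclsN; exact: PN.
Qed.

Section Lift.
Variable W : zmodType.
Variable f : U -> V -> W.

Fixpoint teval (s : tterm) : W :=
  match s with
  | TTZero => 0
  | TTPure x v => f x v
  | TTAdd s t => teval s + teval t
  | TTOpp s => - teval s
  end.

Definition balanced : Prop :=
  [/\ forall x y v, f (x + y) v = f x v + f y v,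
      forall x v w, f x (v + w) = f x v + f x w &
      forall x a v, f (ract x a) v = f x (lact a v)].

(* the additive map x (x) v |-> f x v; it exists exactly when f is balanced   *)
(* (tlift_pure below), and the value is the zero map otherwise                *)
Definition tlift : tensor_sort -> W :=
  xget (fun=> 0) [set h : tensor_sort -> W | {morph h : s t / s + t} /\
      forall x v, h (pure x v) = f x v]%classic.

Lemma teval_congr : balanced ->
  forall s t, tcongr s t -> teval s = teval t.
Proof.
move=> [fDl fDr fB] s t; elim=> {s t} //=.
- by move=> s t u _ -> _ ->.
- by move=> s s' t t' _ -> _ ->.
- by move=> s s' _ ->.
- by move=> s t u; rewrite addrA.
- by move=> s t; rewrite addrC.
- by move=> s; rewrite add0r.
- by move=> s; rewrite addNr.
Qed.

Lemma tliftD : {morph tlift : s t / s + t}.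
Proof.
rewrite /tlift; case: xgetP => [h _ [hD _]|_ s t] //.
by rewrite addr0.
Qed.

Lemma tlift_pure : balanced -> forall x v, tlift (pure x v) = f x v.
Proof.
move=> fb; rewrite /tlift; case: xgetP => [h _ [_ hp]|] //.
move/(_ (fun t => teval (repr t))) => /= [].
have E s : teval (repr (tcls s)) = teval s.
  exact/(teval_congr fb)/repr_tcls.
split=> [|x v]; last by rewrite /pure E.
by elim/tcls_ind=> s; elim/tcls_ind=> t; rewrite -tclsD !E.
Qed.
End Lift.

Lemma balanced_pure (f : U -> U) (g : V -> V) :
  {morph f : x y / x + y} -> {morph g : x y / x + y} ->
  (forall x a, f (ract x a) = ract (f x) a) ->
  (forall a v, g (lact a v) = lact a (g v)) ->
  balanced (fun x v => pure (f x) (g v)).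
Proof.
move=> fD gD fr gl; split=> [x y v|x v w|x a v].
- by rewrite fD pureDl.
- by rewrite gD pureDr.
- by rewrite fr gl pure_balanced.
Qed.

Definition tensor_lact (a : S) : tensor_sort -> tensor_sort :=
  tlift (fun x v => pure (lact a x) v).
Definition tensor_ract (t : tensor_sort) (a : S) : tensor_sort :=
  tlift (fun x v => pure x (ract v a)) t.

Lemma tensor_lactE a x v : tensor_lact a (pure x v) = pure (lact a x) v.
Proof.
apply: tlift_pure; apply: (balanced_pure (g := id)) => //.
- exact: lactDr.
- by move=> y b; rewrite lactA.
Qed.
Lemma tensor_ractE x v a : tensor_ract (pure x v) a = pure x (ract v a).
Proof.
apply: (tlift_pure (f := fun x v => pure x (ract v a))).
split=> [y z w|y w z|y b w].
- by rewrite pureDl.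
- by rewrite ractDl pureDr.
- by rewrite -lactA pure_balanced.
Qed.

Lemma additive_eq (W : zmodType) (h k : tensor_sort -> W) :
  {morph h : s t / s + t} -> {morph k : s t / s + t} ->
  (forall x v, h (pure x v) = k (pure x v)) -> forall t, h t = k t.
Proof.
move=> hD kD e; have h0 (g : tensor_sort -> W) :
    {morph g : s t / s + t} -> g 0 = 0.
  by move=> gD; apply: (addrI (g 0)); rewrite -gD !addr0.
elim/tensor_ind=> [|||s hs] //; first by rewrite !h0.
- by move=> s t hs ht; rewrite hD kD hs ht.
- apply: (addrI (h s)); rewrite -hD subrr h0 // hs -kD subrr h0 //.
Qed.

Lemma tensor_lactDr a : {morph tensor_lact a : s t / s + t}.
Proof. exact: tliftD. Qed.
Lemma tensor_ractDl a : {morph tensor_ract^~ a : s t / s + t}.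
Proof. by move=> s t; exact: tliftD. Qed.

Lemma tensor_lactDl a b t :
  tensor_lact (a + b) t = tensor_lact a t + tensor_lact b t.
Proof.
move: t; apply: additive_eq => [|s t|x v]; first exact: tensor_lactDr.
- by rewrite !tensor_lactDr addrACA.
- by rewrite !tensor_lactE lactDl pureDl.
Qed.
Lemma tensor_lactM a b t :
  tensor_lact (a * b) t = tensor_lact a (tensor_lact b t).
Proof.
move: t; apply: additive_eq => [|s t|x v]; first exact: tensor_lactDr.
- by rewrite !tensor_lactDr.
- by rewrite !tensor_lactE lactM.
Qed.
Lemma tensor_lact1 t : tensor_lact 1 t = t.
Proof.
move: t; apply: (additive_eq (k := id)) => // [|x v].
- exact: tensor_lactDr.
- by rewrite tensor_lactE lact1.
Qed.
Lemma tensor_ractDr t a b :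
  tensor_ract t (a + b) = tensor_ract t a + tensor_ract t b.
Proof.
move: t; apply: (additive_eq (h := tensor_ract^~ (a + b))
  (k := fun t => tensor_ract t a + tensor_ract t b)) => [|s t|x v].
- exact: tensor_ractDl.
- by rewrite !tensor_ractDl addrACA.
- by rewrite !tensor_ractE ractDr pureDr.
Qed.
Lemma tensor_ractM t a b :
  tensor_ract t (a * b) = tensor_ract (tensor_ract t a) b.
Proof.
move: t; apply: (additive_eq (h := tensor_ract^~ (a * b))
  (k := fun t => tensor_ract (tensor_ract t a) b)) => [|s t|x v].
- exact: tensor_ractDl.
- by rewrite !tensor_ractDl.
- by rewrite !tensor_ractE ractM.
Qed.
Lemma tensor_ract1 t : tensor_ract t 1 = t.
Proof.
move: t; apply: (additive_eq (h := tensor_ract^~ 1) (k := id)) => // [|x v].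
- exact: tensor_ractDl.
- by rewrite tensor_ractE ract1.
Qed.
Lemma tensor_lactA a t b :
  tensor_lact a (tensor_ract t b) = tensor_ract (tensor_lact a t) b.
Proof.
move: t; apply: (additive_eq (h := fun t => tensor_lact a (tensor_ract t b))
  (k := fun t => tensor_ract (tensor_lact a t) b)) => [s t|s t|x v].
- by rewrite !(tensor_ractDl, tensor_lactDr).
- by rewrite !(tensor_ractDl, tensor_lactDr).
- by rewrite !(tensor_ractE, tensor_lactE).
Qed.

Definition tensor : bimodule S := Bimodule
  tensor_lactDl tensor_lactDr tensor_lactM tensor_lact1
  (fun s t a => tensor_ractDl a s t) tensor_ractDr tensor_ractM tensor_ract1
  tensor_lactA.

End Tensor.

Arguments tlift {S U V W} f _.
Arguments pure {S U V} x v.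

Notation "U ⊗ V" := (tensor U V) (at level 40, left associativity).

Section TensorMaps.
Variable S : pzRingType.

(* f (x) g; well defined when f is right S-linear and g is left S-linear *)
Definition tmap (U U' V V' : bimodule S) (f : U -> U') (g : V -> V') :
    U ⊗ V -> U' ⊗ V' :=
  tlift (fun x v => pure (f x) (g v) : U' ⊗ V').

Definition tassocl (U V W : bimodule S) : U ⊗ (V ⊗ W) -> (U ⊗ V) ⊗ W :=
  tlift (V := V ⊗ W) (fun x =>
    tlift (fun v w => pure (U := U ⊗ V) (pure x v) w : (U ⊗ V) ⊗ W)).

Definition tassocr (U V W : bimodule S) : (U ⊗ V) ⊗ W -> U ⊗ (V ⊗ W) :=
  tlift (U := U ⊗ V) (fun t w =>
    tlift (fun x v => pure (V := V ⊗ W) x (pure v w) : U ⊗ (V ⊗ W)) t).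

Lemma tmap_pure (U U' V V' : bimodule S) (f : U -> U') (g : V -> V') :
  {morph f : x y / x + y} -> {morph g : x y / x + y} ->
  (forall x a, f (ract x a) = ract (f x) a) ->
  (forall a v, g (lact a v) = lact a (g v)) ->
  forall x v, tmap f g (pure x v) = pure (f x) (g v).
Proof.
move=> fD gD fr gl; apply: tlift_pure; split=> [x y v|x v w|x a v].
- by rewrite fD pureDl.
- by rewrite gD pureDr.
- by rewrite fr gl pure_balanced.
Qed.

Lemma tassocl_pure (U V W : bimodule S) (x : U) (v : V) (w : W) :
  tassocl (pure (V := V ⊗ W) x (pure v w)) = pure (U := U ⊗ V) (pure x v) w.
Proof.
pose f (y : U) := fun (v : V) (w : W) =>
  pure (U := U ⊗ V) (pure y v) w : (U ⊗ V) ⊗ W.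
have fb y : balanced (f y).
  split=> [? ? ?|? ? ?|v' a ?]; rewrite /f ?pureDr ?pureDl //.
  by rewrite -pure_balanced /= tensor_ractE.
rewrite /tassocl; set F := (X in tlift X).
suff Fb : balanced (V := V ⊗ W) F.
  by rewrite (tlift_pure Fb); exact: (tlift_pure (fb x)).
split=> [y y' t|y t t'|y a t]; last 1 first.
- apply: (additive_eq (h := F (ract y a))
    (k := fun t => F y (tensor_lact a t))) t => [|s t|v' w'].
  + exact: tliftD.
  + by rewrite tensor_lactDr [LHS]tliftD.
  + rewrite tensor_lactE [LHS](tlift_pure (fb _)) [RHS](tlift_pure (fb _)).
    by rewrite /f pure_balanced.
- apply: (additive_eq (h := F (y + y')) (k := fun t => F y t + F y' t)) t
    => [|s t|v' w'].
  + exact: tliftD.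
  + by rewrite /F !tliftD addrACA.
  + rewrite [LHS](tlift_pure (fb _)).
    rewrite [X in _ = X + _](tlift_pure (fb _)).
    rewrite [X in _ = _ + X](tlift_pure (fb _)).
    by rewrite /f !pureDl.
- exact: tliftD.
Qed.

Lemma tassocr_pure (U V W : bimodule S) (x : U) (v : V) (w : W) :
  tassocr (pure (U := U ⊗ V) (pure x v) w) = pure (V := V ⊗ W) x (pure v w).
Proof.
pose f (y : W) := fun (x : U) (v : V) =>
  pure (V := V ⊗ W) x (pure v y) : U ⊗ (V ⊗ W).
have fb y : balanced (f y).
  split=> [? ? ?|? ? ?|x' a ?]; rewrite /f ?pureDr ?pureDl ?pureDr //.
  by rewrite pure_balanced /= tensor_lactE.
rewrite /tassocr; set F := (X in tlift X).
suff Fb : balanced (U := U ⊗ V) F.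
  by rewrite (tlift_pure Fb); exact: (tlift_pure (fb w)).
split=> [t t' y|t y y'|t a y]; last 1 first.
- apply: (additive_eq (h := fun t => F (tensor_ract t a) y)
    (k := fun t => F t (lact a y))) t => [s t|s t|x' v'].
  + by rewrite tensor_ractDl [LHS]tliftD.
  + exact: tliftD.
  + rewrite tensor_ractE [LHS](tlift_pure (fb _)) [RHS](tlift_pure (fb _)).
    by rewrite /f pure_balanced.
- exact: tliftD.
- apply: (additive_eq (h := fun t => F t (y + y'))
    (k := fun t => F t y + F t y')) t => [s t|s t|x' v'].
  + exact: tliftD.
  + by rewrite /F !tliftD addrACA.
  + rewrite [LHS](tlift_pure (fb _)).
    rewrite [X in _ = X + _](tlift_pure (fb _)).
    rewrite [X in _ = _ + X](tlift_pure (fb _)).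
    by rewrite /f !pureDr.
Qed.

End TensorMaps.

Local Open Scope complex_scope.

(* U_q(su(3)): the indices 1, 2 are the elements of 'I_2 *)

Inductive Uq_gen := GK of 'I_2 | GKinv of 'I_2 | GE of 'I_2 | GF of 'I_2.

Section QuantumGroups.
Variables (R : realType) (q : R).

(* q^(z/2), for z : int *)
Definition qhalf (z : int) : R[i] := ((Num.sqrt q)%:C) ^ z.
Definition qpow (z : int) : R[i] := (q%:C) ^ z.

Local Notation K i := (TGen R[i] (GK i)).
Local Notation K' i := (TGen R[i] (GKinv i)).
Local Notation E i := (TGen R[i] (GE i)).
Local Notation F i := (TGen R[i] (GF i)).

Inductive Uq_rel : sterm R[i] Uq_gen -> sterm R[i] Uq_gen -> Prop :=
  | Uq_KKinv i : Uq_rel (K i * K' i)%T 1%T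
  | Uq_KinvK i : Uq_rel (K' i * K i)%T 1%T
  | Uq_starK i : Uq_rel (TStar (K i)) (K i)
  | Uq_starE i : Uq_rel (TStar (E i)) (F i)
  | Uq_KK i j : Uq_rel (K i * K j)%T (K j * K i)%T
  | Uq_KE i : Uq_rel (K i * E i)%T (qpow 1 *: (E i * K i))%T
  | Uq_EF i : Uq_rel (E i * F i - F i * E i)%T
      ((qpow 1 - qpow (-1))^-1 *: (K i * K i - K' i * K' i))%T
  | Uq_KE_neq i j : i != j ->
      Uq_rel (K i * E j)%T (qhalf (-1) *: (E j * K i))%T
  | Uq_EF_neq i j : i != j -> Uq_rel (E i * F j)%T (F j * E i)%T
  | Uq_Serre i j : i != j ->
      Uq_rel (E i * E i * E j + E j * E i * E i)%T
             ((qpow 1 + qpow (-1)) *: (E i * E j * E i))%T.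

Definition Uq := salg Uq_rel.

Definition counit_gen (g : Uq_gen) : R[i] :=
  match g with GK _ | GKinv _ => 1 | GE _ | GF _ => 0 end.

Lemma counit_rel s t : Uq_rel s t -> seval counit_gen s = seval counit_gen t.
Proof.
case=> [i|i|i|i|i j|i|i|i j _|i j _|i j _] //=;
  rewrite ?(conjC0, conjC1, mul0r, mulr0, mul1r, mulr1, addr0, subr0, subrr) //.
all: rewrite ?mulN1r ?subrr ?mulr0 ?oppr0 //.
Qed.

HB.instance Definition _ := GRing.PzRing.on Uq.
HB.instance Definition _ := GRing.PzSemiRing_isNonZero.Build Uq
  (salg_oner_neq0 counit_rel).
HB.instance Definition _ := GRing.Lmodule.on Uq.
HB.instance Definition _ := GRing.LSemiModule_isLSemiAlgebra.Build R[i] Uq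
  (@salg_scaleAl _ _ Uq_rel).
HB.instance Definition _ := GRing.LSemiAlgebra_isSemiAlgebra.Build R[i] Uq
  (@salg_scaleAr _ _ Uq_rel).

Definition UK i : Uq := scls Uq_rel (K i).
Definition UKinv i : Uq := scls Uq_rel (K' i).
Definition UE i : Uq := scls Uq_rel (E i).
Definition UF i : Uq := scls Uq_rel (F i).

Definition counit : Uq -> R[i] := schar counit_gen.

(* coproduct h s: the coproduct of h is the sum of p.1 (x) p.2 over p in s    *)
(* (Sweedler's notation); it is the unital algebra morphism with the given    *)
(* values on generators.                                                      *)
Inductive coproduct : Uq -> seq (Uq * Uq) -> Prop :=
  | coproduct_K i : coproduct (UK i) [:: (UK i, UK i)]
  | coproduct_Kinv i : coproduct (UKinv i) [:: (UKinv i, UKinv i)]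
  | coproduct_E i : coproduct (UE i) [:: (UE i, UK i); (UKinv i, UE i)]
  | coproduct_F i : coproduct (UF i) [:: (UF i, UK i); (UKinv i, UF i)]
  | coproduct_1 : coproduct 1 [:: (1, 1)]
  | coproductD h k s t : coproduct h s -> coproduct k t ->
      coproduct (h + k) (s ++ t)
  | coproductZ c h s : coproduct h s ->
      coproduct (c *: h) [seq (c *: p.1, p.2) | p <- s]
  | coproductM h k s t : coproduct h s -> coproduct k t ->
      coproduct (h * k) [seq (p.1 * r.1, p.2 * r.2) | p <- s, r <- t].

(* antipode h k: S(h) = k, for the unital algebra antimorphism S with the     *)
(* given values on generators                                                 *)
Inductive antipode : Uq -> Uq -> Prop :=
  | antipode_K i : antipode (UK i) (UKinv i)
  | antipode_Kinv i : antipode (UKinv i) (UK i)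
  | antipode_E i : antipode (UE i) (- qpow 1 *: UE i)
  | antipode_F i : antipode (UF i) (- qpow (-1) *: UF i)
  | antipode_1 : antipode 1 1
  | antipodeD h k h' k' : antipode h h' -> antipode k k' ->
      antipode (h + k) (h' + k')
  | antipodeZ c h h' : antipode h h' -> antipode (c *: h) (c *: h')
  | antipodeM h k h' k' : antipode h h' -> antipode k k' ->
      antipode (h * k) (k' * h').

Inductive in_Usu2 : Uq -> Prop :=
  | in_Usu2_K : in_Usu2 (UK ord0)
  | in_Usu2_Kinv : in_Usu2 (UKinv ord0)
  | in_Usu2_E : in_Usu2 (UE ord0)
  | in_Usu2_F : in_Usu2 (UF ord0)
  | in_Usu2_1 : in_Usu2 1
  | in_Usu2_D h k : in_Usu2 h -> in_Usu2 k -> in_Usu2 (h + k)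
  | in_Usu2_Z c h : in_Usu2 h -> in_Usu2 (c *: h)
  | in_Usu2_M h k : in_Usu2 h -> in_Usu2 k -> in_Usu2 (h * k).

(* A(SU_q(3)): the indices 1, 2, 3 are the elements of 'I_3, and (i, j) is    *)
(* the generator with upper index i and lower index j                         *)

Local Notation u i j := (TGen R[i] (i, j)).

Definition perm_length (s : 'S_3) : nat :=
  #|[set p : 'I_3 * 'I_3 | (p.1 < p.2)%N && (s p.2 < s p.1)%N]%SET|.

Inductive SUq3_rel : sterm R[i] ('I_3 * 'I_3) -> sterm R[i] ('I_3 * 'I_3) ->
    Prop :=
  | SUq3_col (i j k : 'I_3) : (i < j)%N ->
      SUq3_rel (u i k * u j k)%T (qpow 1 *: (u j k * u i k))%T
  | SUq3_row (i j k : 'I_3) : (i < j)%N ->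
      SUq3_rel (u k i * u k j)%T (qpow 1 *: (u k j * u k i))%T
  | SUq3_comm (i j k l : 'I_3) : (i < j)%N -> (k < l)%N ->
      SUq3_rel (u i l * u j k)%T (u j k * u i l)%T
  | SUq3_cross (i j k l : 'I_3) : (i < j)%N -> (k < l)%N ->
      SUq3_rel (u i k * u j l - u j l * u i k)%T
               ((qpow 1 - qpow (-1)) *: (u i l * u j k))%T
  | SUq3_det :
      SUq3_rel
        (\big[@TAdd R[i] ('I_3 * 'I_3)/0%T]_(s : 'S_3)
          ((- qpow 1) ^+ perm_length s *:
             (u (inord 0) (s (inord 0)) * u (inord 1) (s (inord 1))
                * u (inord 2) (s (inord 2))))%T)
        1%T
  | SUq3_star (i j k1 k2 l1 l2 : 'I_3) :
      (k1 < k2)%N -> k1 != i -> k2 != i ->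
      (l1 < l2)%N -> l1 != j -> l2 != j ->
      SUq3_rel (TStar (u i j))
        ((- qpow 1) ^ (j%:Z - i%:Z) *:
           (u k1 l1 * u k2 l2 - qpow 1 *: (u k1 l2 * u k2 l1)))%T.

Definition SUq3 := salg SUq3_rel.

(* the *-character u i j |-> delta_ij shows that the relations are consistent *)
Definition SUq3_unit_gen (p : 'I_3 * 'I_3) : R[i] := (p.1 == p.2)%:R.

Lemma SUq3_unit_rel s t : SUq3_rel s t ->
  seval SUq3_unit_gen s = seval SUq3_unit_gen t.
Proof.
have nat_b (a b : bool) : (a%:R : R[i]) * b%:R = (a && b)%:R.
  by rewrite -natrM mulnb.
case=> [i j k ij|i j k ij|i j k l ij kl|i j k l ij kl||i j k1 k2 l1 l2 kk ki1 ki2 ll lj1 lj2];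
  rewrite /= /SUq3_unit_gen /= ?nat_b.
- have z : (i == k) && (j == k) = false.
    by apply/negP=> /andP[/eqP e /eqP e']; rewrite e e' ltnn in ij.
  by rewrite z andbC z mulr0.
- have z : (k == i) && (k == j) = false.
    by apply/negP=> /andP[/eqP e /eqP e']; rewrite -e -e' ltnn in ij.
  by rewrite z andbC z mulr0.
- by rewrite andbC.
- rewrite [_ && (j == l)]andbC mulN1r subrr.
  suff -> : (i == l) && (j == k) = false by rewrite mulr0.
  apply/negP=> /andP[/eqP e /eqP e']; rewrite e e' in ij.
  by have := ltn_trans ij kl; rewrite ltnn.
- have E : forall r (P : pred 'S_3) (G : 'S_3 -> sterm R[i] ('I_3 * 'I_3)),
      seval SUq3_unit_gen (\big[@TAdd R[i] ('I_3 * 'I_3)/0%T]_(s <- r | P s) G s)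
      = \sum_(s <- r | P s) seval SUq3_unit_gen (G s).
    move=> r P G; elim: r => [|x r IH]; first by rewrite !big_nil.
    by rewrite !big_cons; case: ifP => _; rewrite /= ?IH.
  rewrite E (bigD1 (1%g : 'S_3)) //= big1 ?addr0 => [|w w1].
    have -> : perm_length (1%g : 'S_3) = 0%N.
      apply/eqP; rewrite cards_eq0; apply/eqP/setP=> p; rewrite !inE !perm1.
      by case: ltngtP.
    by rewrite expr0 /SUq3_unit_gen /= !perm1 !eqxx !mulr1.
  rewrite /SUq3_unit_gen /= !nat_b.
  suff -> : (inord 0 == w (inord 0)) && (inord 1 == w (inord 1))
               && (inord 2 == w (inord 2)) = false by rewrite mulr0.
  apply: contraNF w1 => /andP[/andP[/eqP e0 /eqP e1] /eqP e2].
  apply/eqP/permP=> i; rewrite perm1.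
  have: i \in [:: inord 0; inord 1; inord 2].
    by rewrite !inE -!val_eqE /= !inordK //; case: i => [[|[|[|]]]].
  by rewrite !inE => /or3P[] /eqP ->.
- move: kk ki1 ki2.
  case: i k1 k2 => [[|[|[|//]]] ?] [[|[|[|//]]] ?] [[|[|[|//]]] ?] //= _ _ _;
  move: ll lj1 lj2;
  case: j l1 l2 => [[|[|[|//]]] ?] [[|[|[|//]]] ?] [[|[|[|//]]] ?] //= _ _ _;
  by rewrite !(mulr0, addr0, mulr1, conjC0, conjC1) // ?subrr ?expr0z.
Qed.

HB.instance Definition _ := GRing.PzRing.on SUq3.
HB.instance Definition _ := GRing.PzSemiRing_isNonZero.Build SUq3
  (salg_oner_neq0 SUq3_unit_rel).
HB.instance Definition _ := GRing.Lmodule.on SUq3.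
HB.instance Definition _ := GRing.LSemiModule_isLSemiAlgebra.Build R[i] SUq3
  (@salg_scaleAl _ _ SUq3_rel).
HB.instance Definition _ := GRing.LSemiAlgebra_isSemiAlgebra.Build R[i] SUq3
  (@salg_scaleAr _ _ SUq3_rel).

Definition su (j k : 'I_3) : SUq3 := scls SUq3_rel (u j k).

(* for i : 'I_2, the indices i and i + 1 in 'I_3 *)
Definition row_lo (i : 'I_2) : 'I_3 := widen_ord (leqnSn 2) i.
Definition row_hi (i : 'I_2) : 'I_3 := lift ord0 i.

(* act a h is a <| h. The formulas determine it, as the su j k generate the   *)
(* *-algebra and the UK i, UKinv i, UE i, UF i generate Uq.                   *)
Record Uq_action := UqAction {
  act :> SUq3 -> Uq -> SUq3;
  actDl : forall a b h, act (a + b) h = act a h + act b h;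
  actZl : forall c a h, act (c *: a) h = c *: act a h;
  actDr : forall a h k, act a (h + k) = act a h + act a k;
  actZr : forall c a h, act a (c *: h) = c *: act a h;
  act1r : forall a, act a 1 = a;
  actMr : forall a h k, act a (h * k) = act (act a h) k;
  actMl : forall a b h s, coproduct h s ->
    act (a * b) h = \sum_(p <- s) act a p.1 * act b p.2;
  act1l : forall h, act 1 h = counit h *: 1;
  act_star : forall a h k, antipode h k ->
    star (act a h) = act (star a) (star k);
  act_K : forall i j k, act (su j k) (UK i) =
    qhalf ((row_hi i == j)%:Z - (row_lo i == j)%:Z) *: su j k;
  act_E : forall i j k, act (su j k) (UE i) =
    if row_hi i == j then su (row_lo i) k else 0;
  act_F : forall i j k, act (su j k) (UF i) =
    if row_lo i == j then su (row_hi i) k else 0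
}.

Variable a : Uq_action.

Local Notation "x ◁ h" := (act a x h) (at level 40, left associativity).
Local Notation i1 := (ord0 : 'I_2).
Local Notation i2 := (ord_max : 'I_2).

Definition in_S5 (x : SUq3) : Prop :=
  forall h, in_Usu2 h -> x ◁ h = counit h *: x.

Definition in_L (N : int) (x : SUq3) : Prop :=
  in_S5 x /\ x ◁ (UK i1 * UK i2 ^+ 2) = qpow N *: x.

Definition Lpred (N : int) : {pred SUq3} := fun x => `[< in_L N x >].

Lemma act0l h : 0 ◁ h = 0.
Proof. by have := actZl a 0 0 h; rewrite !scale0r. Qed.
Lemma actNl x h : (- x) ◁ h = - (x ◁ h).
Proof. by rewrite -scaleN1r actZl scaleN1r. Qed.

Lemma Lpred_zmod N : zmod_closed (Lpred N).
Proof.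
split=> [|x y /asboolP[xS xL] /asboolP[yS yL]]; apply/asboolP; split.
- by move=> h _; rewrite act0l scaler0.
- by rewrite act0l scaler0.
- by move=> h hS; rewrite actDl actNl xS // yS // scalerBr.
- by rewrite actDl actNl xL yL scalerBr.
Qed.

Lemma actKM x y i : (x * y) ◁ UK i = (x ◁ UK i) * (y ◁ UK i).
Proof. by rewrite (actMl a x y (coproduct_K i)) big_seq1. Qed.
Lemma actKinvM x y i : (x * y) ◁ UKinv i = (x ◁ UKinv i) * (y ◁ UKinv i).
Proof. by rewrite (actMl a x y (coproduct_Kinv i)) big_seq1. Qed.
Lemma actEM x y i :
  (x * y) ◁ UE i = (x ◁ UE i) * (y ◁ UK i) + (x ◁ UKinv i) * (y ◁ UE i).
Proof. by rewrite (actMl a x y (coproduct_E i)) big_cons big_seq1. Qed.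
Lemma actFM x y i :
  (x * y) ◁ UF i = (x ◁ UF i) * (y ◁ UK i) + (x ◁ UKinv i) * (y ◁ UF i).
Proof. by rewrite (actMl a x y (coproduct_F i)) big_cons big_seq1. Qed.
Lemma actKKM x y : (x * y) ◁ (UK i1 * UK i2 ^+ 2) =
  (x ◁ (UK i1 * UK i2 ^+ 2)) * (y ◁ (UK i1 * UK i2 ^+ 2)).
Proof. by rewrite expr2 !actMr !actKM. Qed.

Lemma counitE : [/\ forall i, counit (UK i) = 1, forall i, counit (UKinv i) = 1,
  forall i, counit (UE i) = 0 & forall i, counit (UF i) = 0].
Proof. by split=> i; rewrite /counit schar_scls //; exact: counit_rel. Qed.

Lemma counitD : {morph counit : h k / h + k}.
Proof. exact: scharD counit_rel. Qed.
Lemma counitM : {morph counit : h k / h * k}.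
Proof. exact: scharM counit_rel. Qed.
Lemma counitZ c h : counit (c *: h) = c * counit h.
Proof. exact: scharZ counit_rel _ _. Qed.
Lemma counit1 : counit 1 = 1.
Proof. exact: schar1 counit_rel. Qed.

Lemma in_S5P x : in_S5 x <->
  [/\ x ◁ UK i1 = x, x ◁ UKinv i1 = x, x ◁ UE i1 = 0 & x ◁ UF i1 = 0].
Proof.
have [eK eK' eE eF] := counitE.
split=> [xS|[xK xK' xE xF] h].
  split; rewrite xS; try by constructor.
  - by rewrite eK scale1r.
  - by rewrite eK' scale1r.
  - by rewrite eE scale0r.
  - by rewrite eF scale0r.
elim=> {h} [||||| h k _ IHh _ IHk | c h _ IHh | h k _ IHh _ IHk].
- by rewrite eK scale1r.
- by rewrite eK' scale1r.
- by rewrite eE scale0r.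
- by rewrite eF scale0r.
- by rewrite act1r counit1 scale1r.
- by rewrite actDr counitD scalerDl IHh IHk.
- by rewrite actZr counitZ IHh scalerA.
- by rewrite actMr counitM IHh actZl IHk scalerA.
Qed.

Lemma in_S5M x y : in_S5 x -> in_S5 y -> in_S5 (x * y).
Proof.
move=> /in_S5P[xK xK' xE xF] /in_S5P[yK yK' yE yF]; apply/in_S5P.
rewrite actKM actKinvM actEM actFM xK xK' xE xF yK yK' yE yF.
by rewrite !mul0r !mulr0 addr0.
Qed.

Lemma in_S51 : in_S5 1.
Proof. by move=> h _; rewrite act1l. Qed.

Lemma in_LM N M x y : q != 0 -> in_L N x -> in_L M y -> in_L (N + M) (x * y).
Proof.
move=> q0 [xS xN] [yS yM]; split; first exact: in_S5M.
rewrite actKKM xN yM -scalerAl -scalerAr scalerA /qpow expfzDr //.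
by rewrite -(rmorph0 (real_complex R)) (inj_eq (@complexI R)).
Qed.

Lemma in_L0Ml N x y : in_L 0 x -> in_L N y -> in_L N (x * y).
Proof.
move=> [xS x0] [yS yN]; split; first exact: in_S5M.
by rewrite actKKM x0 yN {1}/qpow expr0z scale1r -scalerAr.
Qed.

Lemma in_L0Mr N x y : in_L N x -> in_L 0 y -> in_L N (x * y).
Proof.
move=> [xS xN] [yS y0]; split; first exact: in_S5M.
by rewrite actKKM xN y0 /qpow expr0z scale1r -scalerAl.
Qed.

Lemma in_L01 : in_L 0 1.
Proof.
split; first exact: in_S51.
have [eK _ _ _] := counitE.
by rewrite act1l expr2 !counitM !eK !mul1r /qpow expr0z.
Qed.

Record L (N : int) := MkL { Lval :> SUq3; LvalP : Lval \in Lpred N }.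

HB.instance Definition _ N := [isSub for @Lval N].
HB.instance Definition _ N := [Choice of L N by <:].
HB.instance Definition _ N := GRing.SubChoice_isSubZmodule.Build
  SUq3 (Lpred N) (L N) (Lpred_zmod N).

Lemma L_in N (x : L N) : in_L N x.
Proof. exact/asboolP/LvalP. Qed.

Definition toL N (x : SUq3) (xL : in_L N x) : L N := MkL (introT (asboolP _) xL).

Definition CP2 := L 0.

Lemma CP2_subring : subring_closed (Lpred 0).
Proof.
split; first exact/asboolP/in_L01.
- exact: (Lpred_zmod 0).2.
- move=> x y /asboolP x0 /asboolP y0; apply/asboolP; exact: in_L0Ml.
Qed.

HB.instance Definition _ := SubChoice.on CP2.
HB.instance Definition _ := GRing.SubChoice_isSubNzRing.Build
  SUq3 (Lpred 0) CP2 CP2_subring.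

Lemma LvalD N (x y : L N) : Lval (x + y) = Lval x + Lval y.
Proof. by []. Qed.
Lemma CP2_valM (x y : CP2) : Lval (x * y) = Lval x * Lval y.
Proof. by []. Qed.
Lemma CP2_val1 : Lval (1 : CP2) = 1.
Proof. by []. Qed.
Lemma CP2_valD (x y : CP2) : Lval (x + y) = Lval x + Lval y.
Proof. by []. Qed.

Definition L_lact N (b : CP2) (x : L N) : L N := toL (in_L0Ml (L_in b) (L_in x)).
Definition L_ract N (x : L N) (b : CP2) : L N := toL (in_L0Mr (L_in x) (L_in b)).

Program Definition L_bimodule (N : int) : bimodule CP2 :=
  @Bimodule CP2 (L N) (@L_lact N) (@L_ract N) _ _ _ _ _ _ _ _ _.
Next Obligation. by apply: val_inj; rewrite /= mulrDl. Qed.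
Next Obligation. by apply: val_inj; rewrite /= mulrDr. Qed.
Next Obligation. by apply: val_inj; rewrite /= mulrA. Qed.
Next Obligation. by apply: val_inj; rewrite /= mul1r. Qed.
Next Obligation. by apply: val_inj; rewrite /= mulrDl. Qed.
Next Obligation. by apply: val_inj; rewrite /= mulrDr. Qed.
Next Obligation. by apply: val_inj; rewrite /= mulrA. Qed.
Next Obligation. by apply: val_inj; rewrite /= mulr1. Qed.
Next Obligation. by apply: val_inj; rewrite /= mulrA. Qed.


(* Omega^(0,1); the pair v is (v_+, v_-) *)
Definition in_Omega (v : SUq3 * SUq3) : Prop :=
  [/\ v.1 ◁ (UK i1 * UK i2 ^+ 2) = qhalf 3 *: v.1 /\
      v.2 ◁ (UK i1 * UK i2 ^+ 2) = qhalf 3 *: v.2,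
      v.1 ◁ UK i1 = qhalf 1 *: v.1 /\ v.2 ◁ UK i1 = qhalf (-1) *: v.2,
      v.1 ◁ UF i1 = 0 /\ v.2 ◁ UF i1 = v.1 &
      v.1 ◁ UE i1 = v.2 /\ v.2 ◁ UE i1 = 0].

Definition Omega_pred : {pred SUq3 * SUq3} := fun v => `[< in_Omega v >].

Lemma Omega_zmod : zmod_closed Omega_pred.
Proof.
split=> [|v w /asboolP[[v1 v2] [v3 v4] [v5 v6] [v7 v8]]
             /asboolP[[w1 w2] [w3 w4] [w5 w6] [w7 w8]]]; apply/asboolP.
  by split; rewrite /= !act0l ?scaler0.
split; rewrite /= !actDl !actNl ?scalerBr.
- by rewrite v1 v2 w1 w2.
- by rewrite v3 v4 w3 w4.
- by rewrite v5 v6 w5 w6 subrr.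
- by rewrite v7 v8 w7 w8 subrr.
Qed.

Lemma in_Omega_l x v : in_L 0 x -> in_Omega v -> in_Omega (x * v.1, x * v.2).
Proof.
move=> [/in_S5P[xK xK' xE xF] x0] [[v1 v2] [v3 v4] [v5 v6] [v7 v8]].
split; rewrite /= ?actKKM ?actKM ?actEM ?actFM ?xK ?xK' ?xE ?xF ?mul0r ?add0r.
- by rewrite x0 v1 v2 /qpow expr0z scale1r -!scalerAr.
- by rewrite v3 v4 -!scalerAr.
- by rewrite v5 v6 mulr0.
- by rewrite v7 v8 mulr0.
Qed.

Lemma in_Omega_r v x : in_Omega v -> in_L 0 x -> in_Omega (v.1 * x, v.2 * x).
Proof.
move=> [[v1 v2] [v3 v4] [v5 v6] [v7 v8]] [/in_S5P[xK xK' xE xF] x0].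
split; rewrite /= ?actKKM ?actKM ?actEM ?actFM ?xK ?xK' ?xE ?xF ?mulr0 ?addr0.
- by rewrite x0 v1 v2 /qpow expr0z scale1r -!scalerAl.
- by rewrite v3 v4 -!scalerAl.
- by rewrite v5 v6 mul0r.
- by rewrite v7 v8 mul0r.
Qed.

Record Omega := MkOmega {
  Omega_val :> SUq3 * SUq3; Omega_valP : Omega_val \in Omega_pred }.

HB.instance Definition _ := [isSub for Omega_val].
HB.instance Definition _ := [Choice of Omega by <:].
HB.instance Definition _ := GRing.SubChoice_isSubZmodule.Build
  (SUq3 * SUq3)%type Omega_pred Omega Omega_zmod.

Lemma Omega_in (v : Omega) : in_Omega v.
Proof. exact/asboolP/Omega_valP. Qed.

Definition toOmega v (vO : in_Omega v) : Omega :=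
  MkOmega (introT (asboolP _) vO).

Definition Omega_lact (b : CP2) (v : Omega) : Omega :=
  toOmega (in_Omega_l (L_in b) (Omega_in v)).
Definition Omega_ract (v : Omega) (b : CP2) : Omega :=
  toOmega (in_Omega_r (Omega_in v) (L_in b)).

Program Definition Omega_bimodule : bimodule CP2 :=
  @Bimodule CP2 Omega Omega_lact Omega_ract _ _ _ _ _ _ _ _ _.
Next Obligation. by apply: val_inj; rewrite /= !mulrDl. Qed.
Next Obligation. by apply: val_inj; rewrite /= !mulrDr. Qed.
Next Obligation. by apply: val_inj; rewrite /= !mulrA. Qed.
Next Obligation. by apply: val_inj; case: (x : Omega) => -[? ?] ?; rewrite /= !mul1r. Qed.
Next Obligation. by apply: val_inj; rewrite /= !mulrDl. Qed.
Next Obligation. by apply: val_inj; rewrite /= !mulrDr. Qed.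
Next Obligation. by apply: val_inj; rewrite /= !mulrA. Qed.
Next Obligation. by apply: val_inj; case: (x : Omega) => -[? ?] ?; rewrite /= !mulr1. Qed.
Next Obligation. by apply: val_inj; rewrite /= !mulrA. Qed.

Local Notation LL N := (L_bimodule N).
Local Notation OO := Omega_bimodule.

(* the dbar operator; it is applied below to elements of A(CP^2_q) only *)
Definition delbar (x : SUq3) : SUq3 * SUq3 :=
  (x ◁ (UF i2 * UF i1), x ◁ UF i2).

Definition qint (n : nat) : R[i] :=
  (qpow n%:Z - qpow (- n%:Z)) / (qpow 1 - qpow (-1)).
Definition qfact (n : nat) : R[i] := \prod_(1 <= m < n.+1) qint m.
Definition qtrinomial (j k l : nat) : R[i] :=
  qpow (- (j * k + k * l + l * j)%N%:Z) *
    (qfact (j + k + l) / (qfact j * qfact k * qfact l)).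

(* z 1, z 2, z 3 *)
Definition z (j : nat) : SUq3 := su (inord 2) (inord j.-1).

(* (psi^N_(j,k,l))^* *)
Definition psi_star (N : int) (j k l : nat) : SUq3 :=
  let m := z 1 ^+ j * z 2 ^+ k * z 3 ^+ l in
  if 0 <= N then sqrtC (qtrinomial j k l) *: m
  else (qpow (- N + j%:Z - l%:Z) * sqrtC (qtrinomial j k l)) *: star m.

Definition psi (N : int) (j k l : nat) : SUq3 := star (psi_star N j k l).

(* q^-N Psi_N^dagger dbar (Psi_N x), the product being taken in A(SU_q(3))^2 *)
Definition nabla_mul (N : int) (x : SUq3) : SUq3 * SUq3 :=
  qpow (- N) *:
    \sum_(p : 'I_(`|N|.+1) * 'I_(`|N|.+1) * 'I_(`|N|.+1)
            | (p.1.1 + p.1.2 + p.2 == `|N|)%N)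
      let e := psi N p.1.1 p.1.2 p.2 in
      (star e * (delbar (e * x)).1, star e * (delbar (e * x)).2).

Definition mul_Omega_L (N : int) : OO ⊗ LL N -> SUq3 * SUq3 :=
  tlift (U := OO) (V := LL N) (fun v x => (v.1 * Lval x, v.2 * Lval x)).

Lemma mul_Omega_L_pure N (v : OO) (x : LL N) :
  mul_Omega_L (pure v x) = (v.1 * Lval x, v.2 * Lval x).
Proof.
apply: tlift_pure; split=> [v' w y|v' y y'|v' b y]; apply/eqP;
  by rewrite xpair_eqE /= ?mulrDl ?mulrDr ?mulrA ?eqxx.
Qed.

(* the preimage of nabla_mul N x under mul_Omega_L, which is injective *)
Definition nabla (N : int) (x : LL N) : OO ⊗ LL N :=
  xget 0 [set t : OO ⊗ LL N | mul_Omega_L t = nabla_mul N (Lval x)]%classic.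

Definition phi1 (N : int) : OO ⊗ LL N -> SUq3 * SUq3 :=
  tlift (U := OO) (V := LL N)
    (fun v x => qhalf N *: (v.1 * Lval x, v.2 * Lval x)).

Definition phi2 (N : int) : LL N ⊗ OO -> SUq3 * SUq3 :=
  tlift (U := LL N) (V := OO)
    (fun x v => qhalf (- N) *: (Lval x * v.1, Lval x * v.2)).

Lemma phi1_pure N (v : OO) (x : LL N) :
  phi1 (pure v x) = qhalf N *: (v.1 * Lval x, v.2 * Lval x).
Proof.
apply: (tlift_pure (f := fun (v : OO) (x : LL N) =>
  qhalf N *: (v.1 * Lval x, v.2 * Lval x))).
split=> [v' w y|v' y y'|v' b y]; rewrite -?scalerDr; congr (_ *: _); apply/eqP;
  by rewrite xpair_eqE /= ?mulrDl ?mulrDr ?mulrA ?eqxx.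
Qed.

Lemma phi2_pure N (x : LL N) (v : OO) :
  phi2 (pure x v) = qhalf (- N) *: (Lval x * v.1, Lval x * v.2).
Proof.
apply: (tlift_pure (f := fun (x : LL N) (v : OO) =>
  qhalf (- N) *: (Lval x * v.1, Lval x * v.2))).
split=> [y y' v'|y v' w|y b v']; rewrite -?scalerDr; congr (_ *: _); apply/eqP;
  by rewrite xpair_eqE /= ?mulrDl ?mulrDr ?mulrA ?eqxx.
Qed.

(* phi1^-1 \o phi2: phi1 is injective and its image contains that of phi2      *)
Definition sigma (N : int) (t : LL N ⊗ OO) : OO ⊗ LL N :=
  xget 0 [set s : OO ⊗ LL N | phi1 s = phi2 t]%classic.

Definition mulL (q0 : q != 0) (N M : int) : LL N ⊗ LL M -> LL (N + M) :=
  tlift (U := LL N) (V := LL M)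
    (fun x y => toL (in_LM q0 (L_in x) (L_in y)) : LL (N + M)).

Lemma mulL_pure (q0 : q != 0) N M (x : LL N) (y : LL M) :
  Lval (mulL q0 (pure x y)) = Lval x * Lval y.
Proof.
rewrite /mulL tlift_pure //; split=> [x1 x2 y1|x1 y1 y2|x1 b y1];
  by apply: val_inj; rewrite /= ?mulrDl ?mulrDr ?mulrA.
Qed.

(* nabla (x) 1 + (sigma (x) 1)(1 (x) nabla) on a pure tensor x (x) y; neither *)
(* summand is balanced over A(CP^2_q), only their sum is                      *)
Definition tensor_connection_pure (N M : int) (x : LL N) (y : LL M) :
    (OO ⊗ LL N) ⊗ LL M :=
  (pure (U := OO ⊗ LL N) (nabla x) y : (OO ⊗ LL N) ⊗ LL M)
  + tmap (U := LL N ⊗ OO) (U' := OO ⊗ LL N) (@sigma N) (@id (LL M))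
      (tassocl (pure (V := OO ⊗ LL M) x (nabla y))).

Definition tensor_connection (N M : int) : LL N ⊗ LL M -> (OO ⊗ LL N) ⊗ LL M :=
  tlift (@tensor_connection_pure N M).

(* Omega (x) L_N (x) L_M -> Omega (x) L_(N + M), multiplying the last factors *)
Definition mul_last (q0 : q != 0) (N M : int) :
    (OO ⊗ LL N) ⊗ LL M -> OO ⊗ LL (N + M) :=
  fun t => tmap (V := LL N ⊗ LL M) (@id OO) (@mulL q0 N M) (tassocr t).

End QuantumGroups.

Arguments nabla {R q} a N x.
Arguments sigma {R q} a N t.
Arguments mulL {R q} a q0 N M _.
Arguments tensor_connection {R q} a N M _.
Arguments tensor_connection_pure {R q} a N M x y.
Arguments mul_last {R q} a q0 N M _.
Arguments L_bimodule {R q} a N.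
Arguments Omega_bimodule {R q} a.

(* Main.v *)
Require Import Defs.
From mathcomp Require Import all_boot all_order all_algebra perm ring.
From mathcomp Require Import reals complex.
From mathcomp Require classical_sets.

(* Expanding [Psi_N^dagger dbar (Psi_N x)] by the Leibniz rule for [F_2] gives a
   term with [Psi_N^dagger (Psi_N <| F_2)], which vanishes because
   [z_j <| F_2 = 0] and [Psi_N^dagger Psi_N = 1]. Hence
   [nabla_N x = q^(-N/2) (x <| F_2 F_1, x <| F_2)], and the proposition is the
   Leibniz rule for [F_2] on [L_N L_M], where [K_2] acts by [q^(N/2)] and
   [q^(M/2)]; the factor [q^-N] in front of the second term is the twist.
   To transport identities from A(SU_q(3))^2 back to the tensor products, the
   multiplication maps are shown to be injective by inserting
   [1 = Psi_(-N)^dagger Psi_(-N)]. The same injectivity shows that the sum of the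
   two terms of the tensor connection is balanced. *)

Set Implicit Arguments.
Unset Strict Implicit.
Unset Printing Implicit Defensive.

Import Order.TTheory GRing.Theory Num.Theory.
Local Open Scope ring_scope.
Local Open Scope complex_scope.

(** * Quantum minors and the sphere relations *)

(** Three obstacles shape the proof. The eigenvalue condition on [K_1 K_2^2] that defines [L_N]
    fixes only the square of [K_2], while the Leibniz rule needs [K_2] itself; since every element
    is a sum of [K_2]-eigenvectors with positive eigenvalues, the root [-q^(N/2)] is excluded. The
    identity [Psi_N^dagger Psi_N = 1] has to be derived from the presentation: it needs two sphere
    relations, one for each order of [z_j] and its adjoint, hence the quantum determinant expanded
    along the third row in two ways, and then a q-multinomial theorem for each sign of [N]. Finally,
    [nabla] and [sigma] are chosen preimages, with value 0 when there is none, so the values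
    prescribed for them must be shown to lie in the image of multiplication; this image is described
    by the equations of [Omega] with the weight shifted by the degree [N]. *)

Section QuantumMinors.
Variables (F : fieldType) (A : algType F) (t : F).
Let s : F := t - t^-1.

Definition qminor (a b : 'I_3 -> A) (j k : 'I_3) : A :=
  a j * b k - t *: (a k * b j).

Variables (a1 a2 a3 b1 b2 b3 c1 c2 c3 : A).
Hypothesis t0 : t != 0.
Hypotheses (a2c1 : a2 * c1 = c1 * a2) (a3c1 : a3 * c1 = c1 * a3)
  (a3c2 : a3 * c2 = c2 * a3) (b2c1 : b2 * c1 = c1 * b2)
  (b3c1 : b3 * c1 = c1 * b3) (b3c2 : b3 * c2 = c2 * b3).
Hypotheses (a1c2 : a1 * c2 - c2 * a1 = s *: (a2 * c1))
  (a1c3 : a1 * c3 - c3 * a1 = s *: (a3 * c1))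
  (a2c3 : a2 * c3 - c3 * a2 = s *: (a3 * c2))
  (b1c2 : b1 * c2 - c2 * b1 = s *: (b2 * c1))
  (b1c3 : b1 * c3 - c3 * b1 = s *: (b3 * c1))
  (b2c3 : b2 * c3 - c3 * b2 = s *: (b3 * c2)).

Let D1 := a2 * b3 - t *: (a3 * b2).
Let D2 := a1 * b3 - t *: (a3 * b1).
Let D3 := a1 * b2 - t *: (a2 * b1).

Lemma minor1_comm : D1 * c1 = c1 * D1.
Proof.
rewrite mulrBl mulrBr -scalerAl -scalerAr -!mulrA b3c1 b2c1 !mulrA.
by rewrite a2c1 a3c1.
Qed.

(** In each monomial of [D2] only the factor from column 1 fails to commute with [c2]. The two
    corrections have columns 2 and 3 left over and assemble into [D1]. *)
Lemma minor2_comm : D2 * c2 = c2 * D2 + s *: (c1 * D1).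
Proof.
have e1 : a1 * b3 * c2 = c2 * (a1 * b3) + s *: (c1 * (a2 * b3)).
  rewrite -mulrA b3c2 !mulrA -[a1 * c2](subrK (c2 * a1)) a1c2 a2c1.
  by rewrite mulrDl -scalerAl addrC.
have e2 : a3 * b1 * c2 = c2 * (a3 * b1) + s *: (c1 * (a3 * b2)).
  rewrite -mulrA -[b1 * c2](subrK (c2 * b1)) b1c2 b2c1 mulrDr -scalerAr.
  by rewrite !mulrA a3c1 a3c2 addrC.
rewrite mulrBl -scalerAl e1 e2 !mulrBr -!scalerAr !scalerBr !scalerDr !scalerA.
by rewrite opprD addrACA [s * t]mulrC.
Qed.

(** Now both factors of each monomial fail to commute with [c3]. The corrections are collected in
    the monomials [P], [X], [Y], [Z] with the third-row entry on the right, which the two previous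
    commutation rules express through [c1 * D1] and [c2 * D2]. *)
Lemma minor3_comm :
  D3 * c3 = c3 * D3 + s *: (c2 * D2) - (s * t^-1) *: (c1 * D1).
Proof.
set P := a3 * b2 * c1; set X := a1 * b3 * c2.
set Y := a3 * b1 * c2; set Z := a2 * b3 * c1.
have m1 : a1 * b2 * c3 = c3 * (a1 * b2) + s *: (P + X).
  rewrite -mulrA -[b2 * c3](subrK (c3 * b2)) b2c3 mulrDr -scalerAr.
  rewrite !mulrA -[a1 * c3](subrK (c3 * a1)) a1c3 mulrDl -scalerAl.
  by rewrite -[a3 * c1 * b2]mulrA -b2c1 scalerDr /P /X !mulrA addrC addrAC addrC addrA.
have m2 : a2 * b1 * c3 = c3 * (a2 * b1) + s *: (Y - s *: P + Z).
  rewrite -mulrA -[b1 * c3](subrK (c3 * b1)) b1c3 mulrDr -scalerAr.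
  rewrite !mulrA -[a2 * c3](subrK (c3 * a2)) a2c3 mulrDl -scalerAl.
  have -> : a3 * c2 * b1 = Y - s *: P.
    rewrite -mulrA -[c2 * b1](subKr (b1 * c2)) b1c2 mulrBr -scalerAr.
    by rewrite /Y /P !mulrA.
  by rewrite addrC (scalerDr s (Y - _)) -/Z [s *: (Y - _) + c3 * _ * _]addrC !addrA.
have d1 : c1 * D1 = Z - t *: P by rewrite -minor1_comm mulrBl -scalerAl.
have d2 : c2 * D2 = X - t *: Y - s *: (c1 * D1).
  by apply: (addIr (s *: (c1 * D1))); rewrite subrK -minor2_comm mulrBl -scalerAl.
have tP : t *: (t *: P) = P + t *: (s *: P).
  by rewrite !scalerA -{2}[P]scale1r -scalerDl; congr (_ *: _); rewrite /s; field.
rewrite mulrBl -scalerAl m1 m2 d2 [s *: (_ - s *: (c1 * D1))]scalerBr.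
rewrite -[RHS]addrA -[X in _ = _ + X]addrA -[X in _ = _ + (_ + X)]opprD [c3 * D3]mulrBr.
rewrite scalerA -scalerDl (_ : s * s + s / t = s * t); last by rewrite /s; field.
rewrite -[(s * t) *: _]scalerA -scalerBr d1 [t *: (Z - _)]scalerBr tP.
rewrite [t *: (c3 * _ + _)]scalerDr opprD addrACA.
rewrite [t *: (s *: (Y - _ + Z))]scalerA [t * s]mulrC -[(s * t) *: _]scalerA.
rewrite -(scalerBr s) -scalerAr; congr (_ + s *: _).
rewrite 2!scalerDr scalerN !opprD !opprK.
by rewrite -!addrA [LHS]addrCA [in LHS](addrCA P) [in LHS](addrA P) [P + _ - _]addrC.
Qed.

(* The quantum determinant expanded along the third row, with the entries of that
   row on the right and on the left. *)
Lemma minor_expansion :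
  D3 * c3 - t *: (D2 * c2) + (t ^+ 2) *: (D1 * c1) =
  c3 * D3 - t^-1 *: (c2 * D2) + (t ^- 2) *: (c1 * D1).
Proof.
rewrite minor3_comm minor2_comm minor1_comm.
set x := c3 * D3; set y := c2 * D2; set v := c1 * D1.
rewrite scalerDr opprD scalerA -!scaleNr.
rewrite -!addrA (addrCA (- (s / t) *: v)) (addrA (s *: y)) -!scalerDl.
by congr (_ + (_ *: _ + _ *: _)); rewrite /s; field.
Qed.
End QuantumMinors.

(** The six listed permutations are distinct because their value triples [h] are, and [3! = 6] then
    shows that the list is exhaustive. *)
Lemma sumS3 (V : zmodType) (f : 'I_3 -> 'I_3 -> 'I_3 -> V) :
  let o i : 'I_3 := inord i in
  \sum_(s : 'S_3) f (s (o 0%N)) (s (o 1%N)) (s (o 2%N)) =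
  f (o 0%N) (o 1%N) (o 2%N) + f (o 1%N) (o 0%N) (o 2%N) +
  (f (o 0%N) (o 2%N) (o 1%N) + f (o 2%N) (o 0%N) (o 1%N)) +
  (f (o 1%N) (o 2%N) (o 0%N) + f (o 2%N) (o 1%N) (o 0%N)).
Proof.
move=> o.
have oE i j : (i < 3)%N -> (j < 3)%N -> (o i == o j) = (i == j).
  by move=> i3 j3; rewrite -val_eqE /= !inordK.
have tpE i j k : tperm i j k = if k == i then j else if k == j then i else k.
  by case: tpermP => [->|->|/eqP/negPf-> /eqP/negPf->]; rewrite ?eqxx //; case: eqP.
pose p01 := tperm (o 0%N) (o 1%N); pose p12 := tperm (o 1%N) (o 2%N).
pose p02 := tperm (o 0%N) (o 2%N).
pose ps : seq 'S_3 := [:: 1%g; p01; p12; (p01 * p12)%g; (p12 * p01)%g; p02].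
pose h (s : 'S_3) := (s (o 0%N), s (o 1%N), s (o 2%N)).
have hE : map h ps = [:: (o 0%N, o 1%N, o 2%N); (o 1%N, o 0%N, o 2%N);
   (o 0%N, o 2%N, o 1%N); (o 2%N, o 0%N, o 1%N); (o 1%N, o 2%N, o 0%N);
   (o 2%N, o 1%N, o 0%N)].
  by rewrite /= /h /p01 /p02 /p12 !permM !perm1 !tpE !(oE, tpE).
have ups : uniq ps.
  by apply: (@map_uniq _ _ h); rewrite hE /= !inE !xpair_eqE !oE.
have ps_all : perm_eq (index_enum 'S_3) ps.
  apply: uniq_perm; rewrite ?index_enum_uniq //.
  have [|//|_ e s] := @uniq_min_size _ ps (index_enum 'S_3) ups.
  - by move=> ? _; rewrite mem_index_enum.
  - by rewrite -sum1_size sum1_card card_Sn.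
  - by rewrite e.
rewrite (perm_big ps) //= -(big_map h xpredT (fun x => f x.1.1 x.1.2 x.2)) hE.
by rewrite !big_cons big_nil /= addr0 !addrA.
Qed.

Lemma perm_lengthE (s : 'S_3) :
  let o i : 'I_3 := inord i in
  perm_length s = ((s (o 1%N) < s (o 0%N)) + (s (o 2%N) < s (o 0%N))
    + (s (o 2%N) < s (o 1%N)))%N.
Proof.
move=> o; rewrite /perm_length cardsE -sum1_card big_mkcond /=.
rewrite -(pair_bigA _ (fun i j : 'I_3 =>
  if (i < j)%N && (s j < s i)%N then 1%N else 0%N)) /=.
have e0 : ord0 = o 0%N by apply: val_inj; rewrite /= inordK.
have e1 : lift ord0 ord0 = o 1%N by apply: val_inj; rewrite /= inordK.
have e2 : lift ord0 (lift ord0 ord0) = o 2%N by apply: val_inj; rewrite /= inordK.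
rewrite !big_ord_recl !big_ord0 e2 e1 e0 /o.
rewrite !(@inordK 2 0, @inordK 2 1, @inordK 2 2) // /= !addn0 !add0n.
by do 3!case: ltnP.
Qed.

(** * Generators, adjoints and the two sphere relations *)

Section Sphere.
Variables (R : realType) (q : R).
Hypothesis q_gt0 : 0 < q.
Local Notation t := (q%:C : R[i]).
Local Notation o i := (inord i : 'I_3).

(* [star] with codomain [SUq3 q] instead of [salg], so that the algebra
   structure of [SUq3 q] is the one inferred on its values. *)
Definition qadj (x : SUq3 q) : SUq3 q := star x.

Lemma qadjD x y : qadj (x + y) = qadj x + qadj y.
Proof. exact: starD. Qed.

Lemma qadjM x y : qadj (x * y) = qadj y * qadj x.
Proof. exact: starM. Qed.

Lemma qadjZ k x : qadj (k *: x) = Num.conj k *: qadj x.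
Proof. exact: starZ. Qed.

Lemma qadjK : involutive qadj.
Proof. exact: starK. Qed.

Lemma qadj0 : qadj 0 = 0.
Proof. by apply: (addrI (qadj 0)); rewrite -qadjD !addr0. Qed.

Lemma qadj1 : qadj 1 = 1.
Proof. by rewrite -[1 in RHS]qadjK -[qadj 1 in RHS]mulr1 qadjM qadjK mulr1. Qed.

Lemma qpow1 : qpow q 1 = t.
Proof. by rewrite /qpow expr1z. Qed.

Lemma qpowN1 : qpow q (-1) = t^-1.
Proof. by rewrite /qpow -exprN1. Qed.

Lemma qC_neq0 : t != 0.
Proof. by rewrite -(rmorph0 (real_complex R)) (inj_eq (@complexI R)) gt_eqF. Qed.

Lemma su_row (i j k : 'I_3) : (i < j)%N ->
  su q k i * su q k j = t *: (su q k j * su q k i).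
Proof.
move=> ij; rewrite -qpow1 /su -!sclsM -sclsZ.
by apply: salg_rel; exact: SUq3_row.
Qed.

Lemma su_comm (i j k l : 'I_3) : (i < j)%N -> (k < l)%N ->
  su q i l * su q j k = su q j k * su q i l.
Proof.
by move=> ij kl; rewrite /su -!sclsM; apply: salg_rel; exact: SUq3_comm.
Qed.

Lemma su_cross (i j k l : 'I_3) : (i < j)%N -> (k < l)%N ->
  su q i k * su q j l - su q j l * su q i k
  = (t - t^-1) *: (su q i l * su q j k).
Proof.
move=> ij kl; rewrite -qpowN1 -qpow1 /su -!sclsM -sclsB -sclsZ.
by apply: salg_rel; exact: SUq3_cross.
Qed.

Lemma qadj_su (i j k1 k2 l1 l2 : 'I_3) :
  (k1 < k2)%N -> k1 != i -> k2 != i -> (l1 < l2)%N -> l1 != j -> l2 != j ->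
  qadj (su q i j) = (- t) ^ (j%:Z - i%:Z) *:
    qminor t (su q k1) (su q k2) l1 l2.
Proof.
move=> *; rewrite -qpow1 /qadj /qminor /su -!sclsM.
rewrite -[qpow q 1 *: _]sclsZ -sclsB -sclsZ scls_star.
by apply: salg_rel; exact: SUq3_star.
Qed.

Lemma su_det : let f i j k := su q (o 0%N) i * su q (o 1%N) j * su q (o 2%N) k in
  \sum_(s : 'S_3) (- t) ^+ perm_length s *: f (s (o 0%N)) (s (o 1%N)) (s (o 2%N))
  = 1.
Proof.
move=> f; rewrite -[1](salg_rel (SUq3_det q)) /f -qpow1.
elim: (index_enum _) => [|s r IH]; first by rewrite !big_nil.
by rewrite !big_cons IH sclsD sclsZ !sclsM.
Qed.

Local Notation a j := (su q (o 0%N) (o j%N)).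
Local Notation b j := (su q (o 1%N) (o j%N)).
Local Notation c j := (su q (o 2%N) (o j%N)).
Local Notation D j k := (qminor t (su q (o 0%N)) (su q (o 1%N)) (o j%N) (o k%N)).

Lemma det_expand : D 0 1 * c 2 - t *: (D 0 2 * c 1) + t ^+ 2 *: (D 1 2 * c 0) = 1.
Proof.
have := su_det; rewrite /=.
under eq_bigr => s _ do rewrite perm_lengthE.
have -> := sumS3 (fun i j k : 'I_3 => (- t) ^+ ((j < i) + (k < i) + (k < j))%N *:
  (su q (o 0%N) i * su q (o 1%N) j * su q (o 2%N) k)).
rewrite /= !inordK //= => <-; rewrite /qminor !mulrBl -!scalerAl.
rewrite expr0 scale1r expr1 sqrrN exprNn -signr_odd expr1 mulN1r !scaleNr.
by rewrite !scalerBr !scalerA opprB -expr2 -exprSr [- _ + _]addrC.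
Qed.

Let ord_lt i j : (i < j)%N -> (j < 3)%N -> (o i < o j)%N.
Proof. by move=> ij j3; rewrite !inordK // (ltn_trans ij). Qed.

Lemma qadj_zE : [/\ qadj (z q 1) = t ^- 2 *: D 1 2, qadj (z q 2) = - t^-1 *: D 0 2
  & qadj (z q 3) = D 0 1].
Proof.
have neq i j : (i < 3)%N -> (j < 3)%N -> i != j -> o i != o j.
  by move=> i3 j3; rewrite -val_eqE /= !inordK.
have e i j : (i < 3)%N -> (j < 3)%N -> (o i)%:Z - (o j)%:Z = i%:Z - j%:Z.
  by move=> i3 j3; rewrite !inordK.
split; rewrite /z /=.
- by rewrite (@qadj_su _ _ (o 0%N) (o 1%N) (o 1%N) (o 2%N)) ?ord_lt ?neq // e //
    (_ : 0%:Z - 2%:Z = - 2%:Z) // -exprnN sqrrN.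
- by rewrite (@qadj_su _ _ (o 0%N) (o 1%N) (o 0%N) (o 2%N)) ?ord_lt ?neq // e //
    (_ : 1%:Z - 2%:Z = -1) // exprN1 invrN.
- by rewrite (@qadj_su _ _ (o 0%N) (o 1%N) (o 0%N) (o 1%N)) ?ord_lt ?neq // e //
    subrr expr0z scale1r.
Qed.

(** The weights [t^4], [t^2], 1 turn the cofactor coefficients [t^-2], [-t^-1], 1 of [qadj_zE] into
    the coefficients [t^2], [-t], 1 of [det_expand]. *)
Lemma star_z_z : t ^+ 4 *: (qadj (z q 1) * z q 1) + t ^+ 2 *: (qadj (z q 2) * z q 2)
  + qadj (z q 3) * z q 3 = 1.
Proof.
have t0 := qC_neq0; have [-> -> ->] := qadj_zE.
rewrite -!scalerAl !scalerA -det_expand /z /=.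
rewrite (_ : t ^+ 4 / t ^+ 2 = t ^+ 2); last by field.
rewrite (_ : t ^+ 2 * - t^-1 = - t); last by field.
by rewrite scaleNr addrC [X in _ + X]addrC addrA.
Qed.

(** With the third-row entries on the left, the cofactor coefficients are already those of the
    right-hand side of [minor_expansion]. *)
Lemma z_star_z : z q 1 * qadj (z q 1) + z q 2 * qadj (z q 2) + z q 3 * qadj (z q 3) = 1.
Proof.
have t0 := qC_neq0; have [-> -> ->] := qadj_zE; rewrite -det_expand /z /=.
have h01 := @ord_lt 0 1 isT isT; have h02 := @ord_lt 0 2 isT isT.
have h12 := @ord_lt 1 2 isT isT.
have := minor_expansion t0
  (su_comm h02 h01) (su_comm h02 h02) (su_comm h02 h12)
  (su_comm h12 h01) (su_comm h12 h02) (su_comm h12 h12)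
  (su_cross h02 h01) (su_cross h02 h02) (su_cross h02 h12)
  (su_cross h12 h01) (su_cross h12 h02) (su_cross h12 h12).
rewrite -!/(qminor _ _ _ _ _) => ->.
by rewrite -!scalerAr scaleNr addrC [X in _ + X]addrC addrA.
Qed.

End Sphere.

(** * Sums over triples and q-trinomial coefficients *)

Section TriangularSums.
Variables (V : zmodType).
Implicit Types (G H : nat -> nat -> nat -> V).

(* The three bounds are separate so that one index can be shifted while the other
   two are widened. *)
Definition trisum (J K L n : nat) G : V :=
  \sum_(j < J) \sum_(k < K) \sum_(l < L) (if (j + k + l == n)%N then G j k l else 0).

Lemma eq_trisum J K L n G H :
  (forall j k l, (j + k + l = n)%N -> G j k l = H j k l) ->
  trisum J K L n G = trisum J K L n H.
Proof.
move=> GH; apply: eq_bigr => j _; apply: eq_bigr => k _; apply: eq_bigr => l _.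
by case: eqP => // /GH.
Qed.

Lemma trisumD J K L n G H :
  trisum J K L n (fun j k l => G j k l + H j k l) =
  trisum J K L n G + trisum J K L n H.
Proof.
rewrite /trisum -big_split; apply: eq_bigr => j _; rewrite -big_split /=.
apply: eq_bigr => k _; rewrite -big_split /=; apply: eq_bigr => l _.
by case: eqP; rewrite ?addr0.
Qed.

Lemma trisum_morph (f : V -> V) J K L n G : f 0 = 0 -> {morph f : x y / x + y} ->
  f (trisum J K L n G) = trisum J K L n (fun j k l => f (G j k l)).
Proof.
move=> f0 fD; rewrite /trisum !(big_morph f fD f0); apply: eq_bigr => j _.
rewrite (big_morph f fD f0); apply: eq_bigr => k _.
rewrite (big_morph f fD f0); apply: eq_bigr => l _.
by case: eqP.
Qed.

Lemma trisum_shift1 J K L n G : (forall k l, G 0%N k l = 0) ->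
  trisum J.+1 K L n.+1 G = trisum J K L n (fun j k l => G j.+1 k l).
Proof.
move=> G0; rewrite /trisum big_ord_recl /= big1 ?add0r // => k _.
by rewrite big1 // => l _; rewrite G0; case: eqP.
Qed.

Lemma trisum_shift2 J K L n G : (forall j l, G j 0%N l = 0) ->
  trisum J K.+1 L n.+1 G = trisum J K L n (fun j k l => G j k.+1 l).
Proof.
move=> G0; apply: eq_bigr => j _; rewrite big_ord_recl /= big1 ?add0r.
  by apply: eq_bigr => k _; apply: eq_bigr => l _; rewrite /bump /= add1n addnS.
by move=> l _; rewrite G0; case: eqP.
Qed.

Lemma trisum_shift3 J K L n G : (forall j k, G j k 0%N = 0) ->
  trisum J K L.+1 n.+1 G = trisum J K L n (fun j k l => G j k l.+1).
Proof.
move=> G0; apply: eq_bigr => j _; apply: eq_bigr => k _; rewrite big_ord_recl /=.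
rewrite G0 if_same add0r.
by apply: eq_bigr => l _; rewrite /bump /= add1n addnS.
Qed.

Lemma trisum_widen1 J K L n G : (n < J)%N ->
  trisum J.+1 K L n G = trisum J K L n G.
Proof.
move=> nJ; rewrite /trisum big_ord_recr /= [X in _ + X]big1 ?addr0 // => k _.
by rewrite big1 // => l _; rewrite gtn_eqF // -addnA ltn_addr.
Qed.

Lemma trisum_widen2 J K L n G : (n < K)%N ->
  trisum J K.+1 L n G = trisum J K L n G.
Proof.
move=> nK; apply: eq_bigr => j _; rewrite big_ord_recr /=.
rewrite [X in _ + X]big1 ?addr0 // => l _.
by rewrite gtn_eqF // addnAC ltn_addl.
Qed.

Lemma trisum_widen3 J K L n G : (n < L)%N ->
  trisum J K L.+1 n G = trisum J K L n G.
Proof.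
move=> nL; apply: eq_bigr => j _; apply: eq_bigr => k _; rewrite big_ord_recr /=.
by rewrite gtn_eqF ?ltn_addl // addr0.
Qed.

Lemma trisumE n G :
  \sum_(p : 'I_n.+1 * 'I_n.+1 * 'I_n.+1 | (p.1.1 + p.1.2 + p.2 == n)%N)
     G p.1.1 p.1.2 p.2 = trisum n.+1 n.+1 n.+1 n G.
Proof.
rewrite big_mkcond /= -(pair_bigA _ (fun (p : 'I_n.+1 * 'I_n.+1) (l : 'I_n.+1) =>
  if (p.1 + p.2 + l == n)%N then G p.1 p.2 l else 0)) /=.
by rewrite -(pair_bigA _ (fun j k : 'I_n.+1 => \sum_(l < n.+1)
  if (j + k + l == n)%N then G j k l else 0)).
Qed.

End TriangularSums.

Section QNumbers.
Variables (R : realType) (q : R).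
Hypotheses (q_gt0 : 0 < q) (q_lt1 : q < 1).
Local Notation t := (q%:C : R[i]).

Let t0 : t != 0. Proof. exact: qC_neq0. Qed.

Lemma qC_gt0 : 0 < t. Proof. by rewrite ltcE /= eqxx. Qed.

Lemma qpowD m n : qpow q (m + n) = qpow q m * qpow q n.
Proof. exact: expfzDr. Qed.

Lemma qpowN m : qpow q (- m) = (qpow q m)^-1.
Proof. by rewrite /qpow invr_expz. Qed.

Lemma qpow0 : qpow q 0 = 1.
Proof. exact: expr0z. Qed.

Lemma qpow_gt0 m : 0 < qpow q m.
Proof. exact: exprz_gt0 qC_gt0. Qed.

Lemma qpow_nat (n : nat) : qpow q n = t ^+ n.
Proof. by []. Qed.

Lemma qint_gt0 n : 0 < qint q n.+1.
Proof.
(* As [q < 1], numerator and denominator of [qint] are both negative. *)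
have neg m : qpow q m.+1 - qpow q (- m.+1%:Z) < 0.
  have t1 : t < 1 by rewrite ltcE /= eqxx.
  rewrite qpowN qpow_nat subr_lt0 (@lt_trans _ _ 1) //.
    by rewrite exprn_ilt1 // ltW ?qC_gt0.
  by rewrite invf_gt1 ?exprn_gt0 ?qC_gt0 // exprn_ilt1 // ltW ?qC_gt0.
by rewrite /qint nmulr_rgt0 ?invr_lt0 neg.
Qed.

Lemma qint0 : qint q 0 = 0.
Proof. by rewrite /qint oppr0 subrr mul0r. Qed.

Lemma qint_neq0 n : qint q n.+1 != 0.
Proof. exact: lt0r_neq0 (qint_gt0 n). Qed.

Lemma qfactS n : qfact q n.+1 = qfact q n * qint q n.+1.
Proof. by rewrite /qfact big_nat_recr. Qed.

Lemma qfact_gt0 n : 0 < qfact q n.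
Proof.
elim: n => [|n IH]; first by rewrite /qfact big_geq.
by rewrite qfactS mulr_gt0 ?qint_gt0.
Qed.

Lemma qtrinomial_ge0 j k l : 0 <= qtrinomial q j k l.
Proof.
apply: ltW; rewrite /qtrinomial; apply: mulr_gt0;
  by rewrite ?qpow_gt0 ?divr_gt0 ?mulr_gt0 ?qfact_gt0.
Qed.

Lemma qtrinomial0 : qtrinomial q 0 0 0 = 1.
Proof. by rewrite /qtrinomial /qfact !big_geq // /qpow expr0z !mul1r invr1. Qed.

Lemma qtrinomialC12 j k l : qtrinomial q j k l = qtrinomial q k j l.
Proof.
rewrite /qtrinomial; congr (qpow _ _ * _).
  by congr (- _%:Z); ring.
by congr (qfact _ _ / _); ring.
Qed.

Lemma qtrinomialC13 j k l : qtrinomial q j k l = qtrinomial q l k j.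
Proof.
rewrite /qtrinomial; congr (qpow _ _ * _).
  by congr (- _%:Z); ring.
by congr (qfact _ _ / _); ring.
Qed.

(** The q-analogue of absorbing [j + 1] into a trinomial coefficient; the power of [q] is the
    increment [k + l] of the quadratic exponent [j k + k l + l j]. *)
Lemma qtrinomialS1 j k l :
  qint q j.+1 * qtrinomial q j.+1 k l =
  qint q (j + k + l).+1 * qpow q (- (k + l)%N%:Z) * qtrinomial q j k l.
Proof.
rewrite /qtrinomial !addSn qfactS qfactS.
rewrite (_ : (_ + _)%N%:Z = (k + l)%N%:Z + (j * k + k * l + l * j)%N%:Z); last first.
  by rewrite -PoszD; congr Posz; ring.
rewrite opprD qpowD.
move: (qint_neq0 j) (lt0r_neq0 (qfact_gt0 j)) (lt0r_neq0 (qfact_gt0 k)).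
move: (lt0r_neq0 (qfact_gt0 l)); move: (qint q _) (qint q _) => x y.
by move: (qfact q j) (qfact q k) (qfact q l) => *; field; apply/and4P.
Qed.

(** The numerators telescope. *)
Lemma qint_sum j k l :
  qint q (j + k + l) = qpow q (k + l)%N * qint q j + qpow q (l%:Z - j%:Z) * qint q k
     + qpow q (- (j + k)%N%:Z) * qint q l.
Proof.
rewrite /qint !mulrA -!mulrDl; congr (_ / _).
rewrite !PoszD !(qpowN, qpowD).
move: (lt0r_neq0 (qpow_gt0 j)) (lt0r_neq0 (qpow_gt0 k)) (lt0r_neq0 (qpow_gt0 l)).
by move: (qpow q j) (qpow q k) (qpow q l) => *; field; apply/and3P.
Qed.

Definition tsum (V : zmodType) n G : V := trisum n.+1 n.+1 n.+1 n G.

Variable V : lmodType R[i].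
Implicit Types m : nat -> nat -> nat -> V.
Local Notation T := (qtrinomial q).

Let shift1 n m : tsum n.+1 (fun j k l => (qint q j * T j k l) *: m j k l) =
  tsum n (fun j k l => (qint q n.+1 * qpow q (- (k + l)%N%:Z) * T j k l) *: m j.+1 k l).
Proof.
rewrite /tsum trisum_shift1 => [|k l]; last by rewrite qint0 mul0r scale0r.
rewrite trisum_widen2 // trisum_widen3 //.
by apply: eq_trisum => j k l <-; rewrite qtrinomialS1.
Qed.

Let shift2 n m : tsum n.+1 (fun j k l => (qint q k * T j k l) *: m j k l) =
  tsum n (fun j k l => (qint q n.+1 * qpow q (- (j + l)%N%:Z) * T j k l) *: m j k.+1 l).
Proof.
rewrite /tsum trisum_shift2 => [|k l]; last by rewrite qint0 mul0r scale0r.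
rewrite trisum_widen1 // trisum_widen3 //.
apply: eq_trisum => j k l <-.
by rewrite qtrinomialC12 qtrinomialS1 [(k + j)%N]addnC [T j k l]qtrinomialC12.
Qed.

Let shift3 n m : tsum n.+1 (fun j k l => (qint q l * T j k l) *: m j k l) =
  tsum n (fun j k l => (qint q n.+1 * qpow q (- (j + k)%N%:Z) * T j k l) *: m j k l.+1).
Proof.
rewrite /tsum trisum_shift3 => [|k l]; last by rewrite qint0 mul0r scale0r.
rewrite trisum_widen1 // trisum_widen2 //.
apply: eq_trisum => j k l <-.
rewrite qtrinomialC13 qtrinomialS1 [T j k l]qtrinomialC13.
by rewrite [(k + j)%N]addnC (_ : l + k + j = j + k + l)%N //; ring.
Qed.

(** A q-Pascal rule in summed form. Both sides are multiplied by [[n+1]], which [qint_sum] splits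
    into three parts; each part is absorbed into the coefficient and its index shifted. The negative
    powers of [t] will cancel those produced by moving a new [z_i] to its place in a monomial. *)
Lemma qtrinomial_sumS n m :
  tsum n.+1 (fun j k l => T j k l *: m j k l) =
  tsum n (fun j k l => T j k l *: (m j.+1 k l + t ^- (2 * j)%N *: m j k.+1 l
                                   + t ^- (2 * (j + k))%N *: m j k l.+1)).
Proof.
have n0 := qint_neq0 n; apply: (scalerI n0).
have sZ c n' G : c *: tsum n' G = tsum n' (fun j k l => c *: G j k l) :> V.
  by apply: trisum_morph; [exact: scaler0|move=> x y; exact: scalerDr].
rewrite !sZ.
transitivity (tsum n.+1 (fun j k l =>
   (qint q j * T j k l) *: (qpow q (k + l)%N *: m j k l) +
   (qint q k * T j k l) *: (qpow q (l%:Z - j%:Z) *: m j k l) +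
   (qint q l * T j k l) *: (qpow q (- (j + k)%N%:Z) *: m j k l))).
  apply: eq_trisum => j k l <-; rewrite qint_sum !scalerA -!scalerDl.
  by congr (_ *: _); ring.
rewrite {1}/tsum !trisumD -!/(tsum _ _) shift1 shift2 shift3 -!trisumD.
apply: eq_trisum => j k l _; rewrite !scalerDr !scalerA.
have e1 : qpow q (- (k + l)%N%:Z) * qpow q (k + l)%N = 1.
  by rewrite -qpowD addNr qpow0.
have e2 : qpow q (- (j + l)%N%:Z) * qpow q (l%:Z - j%:Z) = t ^- (2 * j)%N.
  by rewrite -qpow_nat -qpowN -qpowD; congr qpow; rewrite PoszM !PoszD; ring.
have e3 : qpow q (- (j + k)%N%:Z) * qpow q (- (j + k)%N%:Z) = t ^- (2 * (j + k))%N.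
  by rewrite -qpow_nat -qpowN -qpowD; congr qpow; rewrite PoszM !PoszD; ring.
congr (_ *: _ + _ *: _ + _ *: _).
- by rewrite -[RHS]mulr1 -e1; ring.
- by rewrite -e2; ring.
- by rewrite -e3; ring.
Qed.

(** The mirror image under exchange of [j] and [l], for monomials whose new factor is split off on
    the right. *)
Lemma qtrinomial_sumSr n m :
  tsum n.+1 (fun j k l => T j k l *: m j k l) =
  tsum n (fun j k l => T j k l *: (m j k l.+1 + t ^- (2 * l)%N *: m j k.+1 l
                                   + t ^- (2 * (k + l))%N *: m j.+1 k l)).
Proof.
have tsumC n' G : tsum n' G = tsum n' (fun j k l => G l k j) :> V.
  rewrite /tsum /trisum exchange_big; under eq_bigr do rewrite exchange_big.
  rewrite exchange_big; apply: eq_bigr => l _.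
  apply: eq_bigr => k _; apply: eq_bigr => j _.
  by rewrite [(j + k + l)%N]addnC [(j + k)%N]addnC addnA.
rewrite tsumC [RHS]tsumC.
transitivity (tsum n.+1 (fun j k l => T j k l *: m l k j)).
  by apply: eq_trisum => j k l _; rewrite qtrinomialC13.
rewrite (qtrinomial_sumS n (fun j k l => m l k j)).
by apply: eq_trisum => j k l _; rewrite qtrinomialC13 [(k + j)%N]addnC.
Qed.
End QNumbers.

(** * Partitions of unity *)

Section PartitionOfUnity.
Variables (R : realType) (q : R).
Hypotheses (q_gt0 : 0 < q) (q_lt1 : q < 1).
Local Notation t := (q%:C : R[i]).
Local Notation T := (qtrinomial q).

Definition zmon (j k l : nat) : SUq3 q := z q 1 ^+ j * z q 2 ^+ k * z q 3 ^+ l.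

Lemma z_comm j k : (0 < j)%N -> (j < k)%N -> (k < 4)%N ->
  z q j * z q k = t *: (z q k * z q j).
Proof.
move=> j0 jk k4; have j4 := ltn_trans jk k4.
apply: su_row; rewrite !inordK ?prednK // ?(leq_trans j0 (ltnW jk)) //.
by case: j k j0 jk {k4 j4} => [|j] [].
Qed.

Lemma qcommXl (x y : SUq3 q) n : x * y = t *: (y * x) ->
  x ^+ n * y = t ^+ n *: (y * x ^+ n).
Proof.
move=> xy; elim: n => [|n IH]; first by rewrite mul1r mulr1 scale1r.
by rewrite !exprSr -mulrA xy -scalerAr (mulrA _ y x) IH -scalerAl scalerA mulrC !mulrA.
Qed.

Lemma qcommXr (x y : SUq3 q) n : x * y = t *: (y * x) ->
  x * y ^+ n = t ^+ n *: (y ^+ n * x).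
Proof.
move=> xy; elim: n => [|n IH]; first by rewrite mul1r mulr1 scale1r.
by rewrite !exprSr mulrA IH -scalerAl -(mulrA _ x y) xy -scalerAr scalerA mulrC !mulrA.
Qed.

Lemma zmonS1l j k l : zmon j.+1 k l = z q 1 * zmon j k l.
Proof. by rewrite /zmon exprS !mulrA. Qed.

Lemma zmonS2l j k l : zmon j k.+1 l = t ^+ j *: (z q 2 * zmon j k l).
Proof.
by rewrite /zmon exprS !mulrA (qcommXl _ (@z_comm 1 2 _ _ _)) // -!scalerAl.
Qed.

Lemma zmonS3l j k l : zmon j k l.+1 = t ^+ (j + k) *: (z q 3 * zmon j k l).
Proof.
rewrite /zmon exprS !mulrA -[_ * z q 3]mulrA (qcommXl _ (@z_comm 2 3 _ _ _)) //.
rewrite -scalerAr !mulrA (qcommXl _ (@z_comm 1 3 _ _ _)) // -!scalerAl scalerA.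
by rewrite -exprD addnC.
Qed.

Lemma zmonS3r j k l : zmon j k l.+1 = zmon j k l * z q 3.
Proof. by rewrite /zmon exprSr !mulrA. Qed.

Lemma zmonS2r j k l : zmon j k.+1 l = t ^+ l *: (zmon j k l * z q 2).
Proof.
by rewrite /zmon exprSr -!mulrA (qcommXr _ (@z_comm 2 3 _ _ _)) // -!scalerAr.
Qed.

Lemma zmonS1r j k l : zmon j.+1 k l = t ^+ (k + l) *: (zmon j k l * z q 1).
Proof.
rewrite /zmon exprSr -!mulrA [z q 1 * _]mulrA (qcommXr _ (@z_comm 1 2 _ _ _)) //.
rewrite -scalerAl -!scalerAr -!mulrA (qcommXr _ (@z_comm 1 3 _ _ _)) // -!scalerAr.
by rewrite scalerA -exprD.
Qed.

Lemma conj_qC : Num.conj t = t.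
Proof. by rewrite geC0_conj // ltW ?qC_gt0. Qed.

Lemma conj_qCX n : Num.conj (t ^+ n) = t ^+ n.
Proof. by rewrite rmorphXn /= conj_qC. Qed.

Let t0 : t != 0. Proof. exact: qC_neq0. Qed.

Lemma qC_cancel n : t ^- (2 * n)%N * t ^+ n * t ^+ n = 1.
Proof. by rewrite -mulrA -exprD addnn mul2n mulVf ?expf_neq0. Qed.

(** By [z_star_z] the additive map [f], which sums [z_i x z_i^*] over [i], fixes 1. Applied to the
    sum of degree [n] it gives the sum of degree [n + 1]: reordering a monomial and its adjoint
    produces each power of [t] twice, and [qtrinomial_sumS] contributes the inverse square. *)
Lemma zmon_unit n : tsum n (fun j k l => T j k l *: (zmon j k l * qadj (zmon j k l))) = 1.
Proof.
elim: n => [|n IH].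
  rewrite /tsum /trisum !big_ord1 /= qtrinomial0 scale1r /zmon !expr0 !mulr1.
  by rewrite qadj1 mulr1.
rewrite qtrinomial_sumS //.
pose f x : SUq3 q := z q 1 * x * qadj (z q 1) + z q 2 * x * qadj (z q 2)
  + z q 3 * x * qadj (z q 3).
have f1 : f 1 = 1 by rewrite /f !mulr1 z_star_z.
rewrite -f1 -IH /tsum trisum_morph; first last.
- by move=> x y; rewrite /f !mulrDr !mulrDl [X in X + _ = _]addrACA [LHS]addrACA.
- by rewrite /f !mulr0 !mul0r !addr0.
apply: eq_trisum => j k l _; rewrite /f -!scalerAr -!scalerAl -!scalerDr.
congr (_ *: _); rewrite zmonS1l zmonS2l zmonS3l !qadjZ !qadjM !conj_qCX.
by rewrite -!scalerAl -!scalerAr !scalerA !qC_cancel !scale1r !mulrA.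
Qed.

(* [t ^ (4 j + 2 k)] is the factor [q^(2 (n + j - l))] of [psi_star] for
   [j + k + l = n]. *)
Lemma zmon_unitr n :
  tsum n (fun j k l => (t ^+ (4 * j + 2 * k)%N * T j k l) *:
                       (qadj (zmon j k l) * zmon j k l)) = 1.
Proof.
transitivity (tsum n (fun j k l =>
    T j k l *: (t ^+ (4 * j + 2 * k)%N *: (qadj (zmon j k l) * zmon j k l)))).
  by apply: eq_trisum => j k l _; rewrite scalerA mulrC.
elim: n => [|n IH].
  rewrite /tsum /trisum !big_ord1 /= qtrinomial0 !scale1r /zmon !expr0 !mulr1.
  exact: qadj1.
rewrite qtrinomial_sumSr //.
pose f x : SUq3 q := t ^+ 4 *: (qadj (z q 1) * x * z q 1)
  + t ^+ 2 *: (qadj (z q 2) * x * z q 2) + qadj (z q 3) * x * z q 3.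
have f1 : f 1 = 1 by rewrite /f !mulr1 star_z_z.
rewrite -[RHS]f1 -IH /tsum trisum_morph; first last.
- move=> x y; rewrite /f !mulrDr !mulrDl !scalerDr.
  by rewrite [X in X + _ = _]addrACA [LHS]addrACA.
- by rewrite /f !mulr0 !mul0r !scaler0 !addr0.
apply: eq_trisum => j k l _; rewrite /f -!scalerAr -!scalerAl.
rewrite !(scalerA _ (T j k l)) ![_ * T j k l]mulrC -!(scalerA (T j k l)) -!scalerDr.
congr (_ *: _); rewrite zmonS1r zmonS2r zmonS3r !qadjZ !qadjM !conj_qCX.
have cancel m x : t ^- (2 * m)%N * x * t ^+ m * t ^+ m = x.
  by rewrite [_ * x]mulrC -!mulrA [X in x * X]mulrA qC_cancel mulr1.
rewrite -!scalerAl -!scalerAr !scalerA !cancel -!exprD !mulnS.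
rewrite [(4 * j + (2 + _))%N]addnCA -[(4 + _ + _)%N]addnA !mulrA.
by rewrite [LHS]addrC [X in _ + X = _]addrC addrA.
Qed.

(** This is [Psi_N^dagger Psi_N = 1], since [psi] is the adjoint of [psi_star]. For [N < 0] the
    entry [psi_star] is itself an adjoint, so the adjoint monomial stands on the left and
    [zmon_unitr] applies. *)
Lemma psi_unit N :
  \sum_(p : 'I_(`|N|.+1) * 'I_(`|N|.+1) * 'I_(`|N|.+1)
          | (p.1.1 + p.1.2 + p.2 == `|N|)%N)
    psi_star q N p.1.1 p.1.2 p.2 * qadj (psi_star q N p.1.1 p.1.2 p.2) = 1.
Proof.
rewrite (trisumE _ (fun j k l => psi_star q N j k l * qadj (psi_star q N j k l))).
have sqrtT j k l : sqrtC (T j k l) * Num.conj (sqrtC (T j k l)) = T j k l.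
  by rewrite geC0_conj ?sqrtC_ge0 ?qtrinomial_ge0 // -expr2 sqrtCK.
rewrite -/(tsum _ _); case: (lerP 0 N) => N0.
  rewrite -[RHS](zmon_unit `|N|); apply: eq_trisum => j k l _.
  by rewrite /psi_star N0 -/(zmon _ _ _) qadjZ -scalerAl -scalerAr scalerA sqrtT.
rewrite -[RHS](zmon_unitr `|N|); apply: eq_trisum => j k l jkl.
rewrite /psi_star leNgt N0 /= -/(zmon _ _ _) -/(qadj _) qadjZ qadjK.
rewrite -scalerAl -scalerAr scalerA rmorphM /= mulrACA sqrtT; congr (_ * _ *: _).
rewrite geC0_conj ?ltW ?qpow_gt0 // -qpowD // -qpow_nat.
congr qpow; rewrite -(ltz0_abs N0) -jkl (PoszD (4 * j)%N) !PoszM !PoszD; ring.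
Qed.

End PartitionOfUnity.

(** * Weights of the action *)

Section UqRelations.
Variables (R : realType) (q : R).
Hypothesis q_gt0 : 0 < q.
Local Notation UK := (UK q).
Local Notation UKinv := (UKinv q).
Local Notation UE := (UE q).
Local Notation UF := (UF q).

Let h0 : (Num.sqrt q)%:C != 0 :> R[i].
Proof.
by rewrite -(rmorph0 (real_complex R)) (inj_eq (@complexI R)) gt_eqF ?sqrtr_gt0.
Qed.

Lemma qhalfD m n : qhalf q (m + n) = qhalf q m * qhalf q n.
Proof. exact: expfzDr. Qed.

Lemma qhalf_gt0 m : 0 < qhalf q m.
Proof. by apply: exprz_gt0; rewrite ltcE /= eqxx sqrtr_gt0. Qed.

Lemma qhalf_neq0 m : qhalf q m != 0.
Proof. exact: lt0r_neq0 (qhalf_gt0 m). Qed.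

Lemma qhalf0 : qhalf q 0 = 1.
Proof. exact: expr0z. Qed.

Lemma qpow_qhalf m : qpow q m = qhalf q (m + m).
Proof.
rewrite qhalfD /qhalf -expfzMl /qpow -rmorphM /= -expr2 sqr_sqrtr //.
exact: ltW.
Qed.

Lemma conj_qhalf m : Num.conj (qhalf q m) = qhalf q m.
Proof. by rewrite geC0_conj // ltW ?qhalf_gt0. Qed.

Lemma conj_qpow m : Num.conj (qpow q m) = qpow q m.
Proof. by rewrite geC0_conj // ltW ?qpow_gt0. Qed.

Definition ustar (h : Uq q) : Uq q := star h.

Lemma ustarM h k : ustar (h * k) = ustar k * ustar h.
Proof. exact: starM. Qed.

Lemma ustarD h k : ustar (h + k) = ustar h + ustar k.
Proof. exact: starD. Qed.

Lemma ustarZ c h : ustar (c *: h) = Num.conj c *: ustar h.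
Proof. exact: starZ. Qed.

Lemma ustarK h : ustar (ustar h) = h.
Proof. exact: starK. Qed.

Lemma ustar_K i : ustar (UK i) = UK i.
Proof. by rewrite /ustar scls_star; apply: salg_rel; exact: Uq_starK. Qed.

Lemma ustar_E i : ustar (UE i) = UF i.
Proof. by rewrite /ustar scls_star; apply: salg_rel; exact: Uq_starE. Qed.

Lemma ustar_F i : ustar (UF i) = UE i.
Proof. by rewrite -ustar_E ustarK. Qed.

Lemma UKKinv i : UK i * UKinv i = 1.
Proof. by rewrite -[LHS]sclsM; apply: salg_rel; exact: Uq_KKinv. Qed.

Lemma ustar1 : ustar 1 = 1.
Proof. by rewrite -[RHS]ustarK -[ustar 1 in RHS]mulr1 ustarM ustarK mulr1. Qed.

(** The presentation gives no adjoint for the inverse of [K_i]; it is forced by uniqueness of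
    inverses. *)
Lemma ustar_Kinv i : ustar (UKinv i) = UKinv i.
Proof.
have e : ustar (UKinv i) * UK i = 1 by rewrite -(ustar_K i) -ustarM UKKinv ustar1.
by rewrite -[LHS]mulr1 -(UKKinv i) mulrA e mul1r.
Qed.

(** The presentation states these commutations, and the Serre relation below, for the [E_i] only;
    the versions for the [F_i] are their adjoints. *)
Lemma UFK i : UF i * UK i = qpow q 1 *: (UK i * UF i).
Proof.
have : UK i * UE i = qpow q 1 *: (UE i * UK i).
  by rewrite -[LHS]sclsM -[UE i * _]sclsM -[RHS]sclsZ; apply: salg_rel; exact: Uq_KE.
by move/(congr1 ustar); rewrite ustarZ !ustarM ustar_K ustar_E conj_qpow.
Qed.

Lemma UFK_neq i j : i != j -> UF j * UK i = qhalf q (-1) *: (UK i * UF j).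
Proof.
move=> ij; have : UK i * UE j = qhalf q (-1) *: (UE j * UK i).
  rewrite -[LHS]sclsM -[UE j * _]sclsM -[RHS]sclsZ; apply: salg_rel.
  exact: Uq_KE_neq.
by move/(congr1 ustar); rewrite ustarZ !ustarM ustar_K ustar_E conj_qhalf.
Qed.

Lemma UEF_neq i j : i != j -> UE i * UF j = UF j * UE i.
Proof.
by move=> ij; rewrite -[LHS]sclsM -[RHS]sclsM; apply: salg_rel; exact: Uq_EF_neq.
Qed.

Lemma UEF i : UE i * UF i - UF i * UE i =
  (qpow q 1 - qpow q (-1))^-1 *: (UK i * UK i - UKinv i * UKinv i).
Proof.
rewrite -(sclsM _ (TGen _ (GE i))) -(sclsM _ (TGen _ (GF i))) -(sclsM _ (TGen _ (GK i))).
rewrite -(sclsM _ (TGen _ (GKinv i))) -!sclsB -sclsZ; apply: salg_rel; exact: Uq_EF.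
Qed.

Lemma UF_serre i j : i != j -> UF j * UF i * UF i + UF i * UF i * UF j =
  (qpow q 1 + qpow q (-1)) *: (UF i * UF j * UF i).
Proof.
move=> ij.
have : UE i * UE i * UE j + UE j * UE i * UE i =
    (qpow q 1 + qpow q (-1)) *: (UE i * UE j * UE i).
  rewrite -!(sclsM _ (TGen _ (GE _)) (TGen _ (GE _))) -!sclsM -sclsD -sclsZ.
  by apply: salg_rel; exact: Uq_Serre.
move/(congr1 ustar); rewrite ustarZ ustarD !ustarM !ustar_E rmorphD /= !conj_qpow.
by rewrite !mulrA.
Qed.

End UqRelations.

Section Weights.
Variables (R : realType) (q : R).
Hypothesis q_gt0 : 0 < q.
Variable a : Uq_action q.
Local Notation "x ◁ h" := (act a x h) (at level 40, left associativity).
Local Notation i1 := (ord0 : 'I_2).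
Local Notation i2 := (ord_max : 'I_2).
Local Notation UK := (UK q).
Local Notation UKinv := (UKinv q).
Local Notation UE := (UE q).
Local Notation UF := (UF q).

Lemma qadj_actK x i : qadj (x ◁ UK i) = qadj x ◁ UKinv i.
Proof. by rewrite /qadj (act_star _ _ (antipode_K q i)) [star (UKinv i)]ustar_Kinv. Qed.

Lemma qadj_actKinv x i : qadj (x ◁ UKinv i) = qadj x ◁ UK i.
Proof. by rewrite /qadj (act_star _ _ (antipode_Kinv q i)) [star (UK i)]ustar_K. Qed.

Lemma qadj_actE x i : qadj (x ◁ UE i) = - qpow q 1 *: (qadj x ◁ UF i).
Proof.
rewrite /qadj (act_star _ _ (antipode_E q i)) -[star (_ *: _)]/(ustar _) ustarZ ustar_E.
by rewrite rmorphN /= conj_qpow // actZr.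
Qed.

Lemma qadj_actF x i : qadj (x ◁ UF i) = - qpow q (-1) *: (qadj x ◁ UE i).
Proof.
rewrite /qadj (act_star _ _ (antipode_F q i)) -[star (_ *: _)]/(ustar _) ustarZ ustar_F.
by rewrite rmorphN /= conj_qpow // actZr.
Qed.

Lemma actKK' x i : x ◁ UK i ◁ UKinv i = x.
Proof. by rewrite -actMr UKKinv act1r. Qed.

Lemma weight_Kinv x i k : x ◁ UK i = qhalf q k *: x -> x ◁ UKinv i = qhalf q (- k) *: x.
Proof.
move=> xk; apply: (scalerI (qhalf_neq0 q_gt0 k)).
by rewrite -actZl -xk actKK' scalerA -(qhalfD q_gt0) subrr qhalf0 scale1r.
Qed.

Lemma weight_qadj x i k : x ◁ UK i = qhalf q k *: x ->
  qadj x ◁ UK i = qhalf q (- k) *: qadj x.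
Proof.
by move/weight_Kinv/(congr1 (@qadj _ _)); rewrite qadj_actKinv qadjZ conj_qhalf.
Qed.

Lemma weightM x y i k l : x ◁ UK i = qhalf q k *: x -> y ◁ UK i = qhalf q l *: y ->
  (x * y) ◁ UK i = qhalf q (k + l) *: (x * y).
Proof. by move=> xk yl; rewrite actKM xk yl -scalerAl -scalerAr scalerA qhalfD. Qed.

Lemma weight1 i : 1 ◁ UK i = qhalf q 0 *: (1 : SUq3 q).
Proof. by have [e _ _ _] := counitE q; rewrite act1l e. Qed.

Lemma act1F i : 1 ◁ UF i = 0.
Proof. by have [_ _ _ e] := counitE q; rewrite act1l e scale0r. Qed.

(** Finite sums of eigenvectors of [K_i]; weights may repeat, and no directness of the sum is
    claimed. *)
Inductive weight_sum (i : 'I_2) : SUq3 q -> Prop :=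
  | weight_sum0 : weight_sum i 0
  | weight_sumD x y k : x ◁ UK i = qhalf q k *: x -> weight_sum i y ->
      weight_sum i (x + y).

Lemma weight_sum1 i x k : x ◁ UK i = qhalf q k *: x -> weight_sum i x.
Proof. by move=> xk; rewrite -[x]addr0; apply: weight_sumD xk (weight_sum0 i). Qed.

Lemma weight_sum_add i x y : weight_sum i x -> weight_sum i y -> weight_sum i (x + y).
Proof.
elim=> [|x' y' k xk _ IH] ys; rewrite ?add0r // -addrA.
exact: weight_sumD xk (IH ys).
Qed.

(** Generators are eigenvectors, products add weights and adjoints negate them, so induction on the
    expression representing [x] suffices. *)
Lemma weight_sum_all i x : weight_sum i x.
Proof.
elim/salg_ind: x; elim=> [[j k]|||s IHs r IHr|s IHs r IHr|c s IHs|s IHs].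
- by apply: weight_sum1; exact: act_K.
- exact: weight_sum0.
- exact: weight_sum1 (weight1 i).
- by rewrite sclsD; exact: weight_sum_add.
- rewrite sclsM -[_ * _]/((_ : SUq3 q) * _).
  elim: IHs => [|x y k xk _ IH]; first by rewrite mul0r; exact: weight_sum0.
  rewrite mulrDl; apply: weight_sum_add IH.
  elim: IHr => [|x' y' l yl _ IH]; first by rewrite mulr0; exact: weight_sum0.
  by rewrite mulrDr; apply: weight_sum_add IH; exact: weight_sum1 (weightM xk yl).
- rewrite sclsZ -[_ *: _]/(_ *: (_ : SUq3 q)).
  elim: IHs => [|x y k xk _ IH]; first by rewrite scaler0; exact: weight_sum0.
  rewrite scalerDr; apply: weight_sum_add IH; apply: (@weight_sum1 _ _ k).
  by rewrite actZl xk !scalerA mulrC.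
- rewrite -scls_star -[star _]/(qadj _).
  elim: IHs => [|x y k xk _ IH]; first by rewrite qadj0; exact: weight_sum0.
  rewrite qadjD; apply: weight_sum_add IH; exact: weight_sum1 (weight_qadj xk).
Qed.

(* Each [x] is killed by a product of factors [K_i - q^(k/2)], none of which
   vanishes at a negative eigenvalue. *)
Lemma no_negative_weight i x c : 0 < c -> x ◁ UK i = - c *: x -> x = 0.
Proof.
pose P ks : Uq q := \prod_(k <- ks) (UK i - (qhalf q k)%:A).
have fac y k : y ◁ (UK i - (qhalf q k)%:A) = y ◁ UK i - qhalf q k *: y.
  by rewrite actDr -scaleNr actZr act1r scaleNr.
have eig y d ks : y ◁ UK i = d *: y -> y ◁ P ks = \prod_(k <- ks) (d - qhalf q k) *: y.
  move=> yd; elim: ks => [|k ks IH]; rewrite /P ?big_nil ?act1r ?scale1r //.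
  by rewrite !big_cons actMr fac yd -scalerBl actZl [_ ◁ _]IH scalerA.
move=> c0 xc; have [ks xks] : exists ks, x ◁ P ks = 0.
  elim: (weight_sum_all i x) => [|y y' k yk _ [ks IH]].
    by exists [::]; rewrite act0l.
  exists (rcons ks k); rewrite /P -cats1 big_cat big_seq1 /=.
  rewrite actDl !actMr [y' ◁ _]IH act0l addr0.
  by rewrite [y ◁ _](eig _ _ _ yk) actZl fac yk subrr scaler0.
move: xks; rewrite (eig _ _ _ xc) => /eqP; rewrite scaler_eq0 => /orP[|/eqP//].
rewrite prodf_seq_eq0 => /hasP[k _ /=]; rewrite -opprD oppr_eq0.
by rewrite gt_eqF // addr_gt0 // qhalf_gt0.
Qed.

(** On invariant elements [K_1] acts trivially, so [K_2^2] acts by [c^2] with [c = q^(N/2)]. Then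
    [x ◁ K_2 - c x] has eigenvalue [-c] under [K_2], and vanishes by [no_negative_weight]. *)
Lemma in_LP N x : in_L a N x <-> in_S5 a x /\ x ◁ UK i2 = qhalf q N *: x.
Proof.
have KK y : in_S5 a y -> y ◁ (UK i1 * UK i2 ^+ 2) = y ◁ UK i2 ◁ UK i2.
  by move=> /in_S5P[yK _ _ _]; rewrite expr2 !actMr yK.
have cc : qpow q N = qhalf q N * qhalf q N.
  by rewrite (qpow_qhalf q_gt0) (qhalfD q_gt0).
rewrite /in_L cc; move: (qhalf q N) (qhalf_gt0 q_gt0 N) {cc} => c c0.
split=> -[xS xN]; (split; first exact: xS); last first.
  by rewrite (KK _ xS) xN actZl xN scalerA.
move: xN; rewrite (KK _ xS) => xN; apply/eqP; rewrite -subr_eq0; apply/eqP.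
apply: (no_negative_weight c0 (i := i2)).
by rewrite actDl actNl actZl xN scalerBr !scaleNr scalerA opprK addrC.
Qed.

End Weights.

(** * The connection in closed form *)

Lemma sum_pair (V W : zmodType) (I : Type) (r : seq I) (P : pred I)
    (f : I -> V) (g : I -> W) :
  \sum_(i <- r | P i) (f i, g i) =
  (\sum_(i <- r | P i) f i, \sum_(i <- r | P i) g i).
Proof. by apply: (big_rec3 (fun x y w => w = (x, y))) => // i x y _ _ ->. Qed.

Lemma scale_pair (K : pzRingType) (V W : lmodType K) c (v : V) (w : W) :
  c *: (v, w) = (c *: v, c *: w).
Proof. by []. Qed.

Section Connection.
Variables (R : realType) (q : R).
Hypotheses (q_gt0 : 0 < q) (q_lt1 : q < 1).
Variable a : Uq_action q.
Local Notation "x ◁ h" := (act a x h) (at level 40, left associativity).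
Local Notation i1 := (ord0 : 'I_2).
Local Notation i2 := (ord_max : 'I_2).
Local Notation UK := (UK q).
Local Notation UKinv := (UKinv q).
Local Notation UF := (UF q).

Let q0 : q != 0. Proof. exact: lt0r_neq0. Qed.

Lemma in_LZ N c x : in_L a N x -> in_L a N (c *: x).
Proof.
move=> [xS xN]; split=> [h hS|]; first by rewrite actZl xS // !scalerA mulrC.
by rewrite actZl xN !scalerA mulrC.
Qed.

(** The adjoint inverts the action of each [K_i] and exchanges those of [E_1] and [F_1] up to a
    nonzero scalar. *)
Lemma in_L_qadj N x : in_L a N x -> in_L a (- N) (qadj x).
Proof.
move=> /(in_LP q_gt0)[/in_S5P[xK xK' xE xF] xN]; apply/(in_LP q_gt0); split.
  apply/in_S5P; split.
  - by rewrite -qadj_actKinv xK'.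
  - by rewrite -qadj_actK xK.
  - apply/eqP; have /eqP := qadj_actF q_gt0 a x i1.
    rewrite xF qadj0 eq_sym scaler_eq0 oppr_eq0 => /orP[|//].
    by rewrite gt_eqF // qpow_gt0.
  - apply/eqP; have /eqP := qadj_actE q_gt0 a x i1.
    rewrite xE qadj0 eq_sym scaler_eq0 oppr_eq0 => /orP[|//].
    by rewrite gt_eqF // qpow_gt0.
exact: weight_qadj.
Qed.

Lemma in_LX N x n : in_L a N x -> in_L a (n%:Z * N) (x ^+ n).
Proof.
move=> xN; elim: n => [|n IH]; first by rewrite mul0r; exact: in_L01.
by rewrite exprS intS mulrDl mul1r; exact: in_LM.
Qed.

Lemma row_loE (i : 'I_2) : row_lo i = inord i.
Proof. by apply: val_inj; rewrite /= inordK // (ltn_trans (ltn_ord i)). Qed.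

Lemma row_hiE (i : 'I_2) : row_hi i = inord i.+1.
Proof. by apply: val_inj; rewrite /= inordK // ltnS ltn_ord. Qed.

Let row_eq i j : (i < 3)%N -> (j < 3)%N -> (inord i == inord j :> 'I_3) = (i == j).
Proof. by move=> i3 j3; rewrite -val_eqE /= !inordK. Qed.

Lemma z_in_L j : in_L a 1 (z q j).
Proof.
have zK i : z q j ◁ UK i = qhalf q (i == i2)%:Z *: z q j.
  by rewrite act_K row_loE row_hiE !row_eq //; case: i => [[|[]]].
apply/(in_LP q_gt0); split; last by rewrite zK.
apply/in_S5P; split.
- by rewrite zK qhalf0 scale1r.
- by rewrite (weight_Kinv q_gt0 (zK _)) qhalf0 scale1r.
- by rewrite act_E row_hiE row_eq.
- by rewrite act_F row_loE row_eq.
Qed.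

Lemma z_F2 j : z q j ◁ UF i2 = 0.
Proof. by rewrite act_F row_loE row_eq. Qed.

Lemma zmon_in_L j k l : in_L a (j + k + l)%N (zmon q j k l).
Proof.
have zX i n : in_L a n%:Z (z q i ^+ n) by have := in_LX n (z_in_L i); rewrite mulr1.
by rewrite !PoszD /zmon; do 2?apply: in_LM.
Qed.

Lemma in_L_F2M N M x y : in_L a N x -> in_L a M y -> (x * y) ◁ UF i2 =
  qhalf q M *: ((x ◁ UF i2) * y) + qhalf q (- N) *: (x * (y ◁ UF i2)).
Proof.
move=> /(in_LP q_gt0)[_ xN] /(in_LP q_gt0)[_ yM].
by rewrite actFM yM (weight_Kinv q_gt0 xN) -scalerAl -scalerAr.
Qed.

Lemma zmon_F2 j k l : zmon q j k l ◁ UF i2 = 0.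
Proof.
have zX i n : in_L a n%:Z (z q i ^+ n) by have := in_LX n (z_in_L i); rewrite mulr1.
have zXF i n : z q i ^+ n ◁ UF i2 = 0.
  elim: n => [|n IH]; first by rewrite act1F.
  by rewrite exprS (in_L_F2M (z_in_L i) (zX i n)) IH z_F2 mul0r mulr0 !scaler0 addr0.
rewrite /zmon (in_L_F2M (in_LM q0 (zX _ _) (zX _ _)) (zX _ _)).
rewrite (in_L_F2M (zX _ _) (zX _ _)) !zXF.
by rewrite !(mulr0, mul0r, scaler0, addr0).
Qed.

Lemma psi_star_in_L N j k l : (j + k + l = `|N|)%N -> in_L a N (psi_star q N j k l).
Proof.
rewrite /psi_star; case: lerP => N0 jkl; apply: in_LZ.
  by rewrite -(gez0_abs N0) -jkl; exact: zmon_in_L.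
rewrite -[N]opprK -(ltz0_abs N0) -jkl.
exact: in_L_qadj (zmon_in_L j k l).
Qed.

(** For [N < 0] the entries of [Psi_N] are multiples of monomials in the [z_j], so every term
    vanishes. For [N >= 0] they are adjoints of such monomials and only the sum vanishes: apply
    [F_2] to [psi_unit], where the derivatives of the left factors are zero. *)
Lemma psi_F2 N :
  \sum_(p : 'I_(`|N|.+1) * 'I_(`|N|.+1) * 'I_(`|N|.+1)
          | (p.1.1 + p.1.2 + p.2 == `|N|)%N)
    psi_star q N p.1.1 p.1.2 p.2 * (qadj (psi_star q N p.1.1 p.1.2 p.2) ◁ UF i2) = 0.
Proof.
case: (lerP 0 N) => N0; last first.
  apply: big1 => p _; rewrite {2}/psi_star leNgt N0 /= -/(zmon _ _ _ _) -/(qadj _).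
  by rewrite qadjZ qadjK actZl zmon_F2 scaler0 mulr0.
apply: (scalerI (qhalf_neq0 q_gt0 (- N))); rewrite scaler0.
have := congr1 (fun x => x ◁ UF i2) (psi_unit q_gt0 q_lt1 N) => /=.
rewrite act1F => e; rewrite -[RHS]e.
rewrite (big_morph (fun x => x ◁ UF i2) (fun x y => actDl a x y _) (act0l a _)).
rewrite scaler_sumr; apply: eq_bigr => p /eqP jkl.
rewrite (in_L_F2M (psi_star_in_L jkl) (in_L_qadj (psi_star_in_L jkl))).
have -> : psi_star q N p.1.1 p.1.2 p.2 ◁ UF i2 = 0.
  by rewrite /psi_star N0 -/(zmon _ _ _ _) actZl zmon_F2 scaler0.
by rewrite mul0r scaler0 add0r.
Qed.

Definition dbar_twisted N x : SUq3 q * SUq3 q :=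
  qhalf q (- N) *: (x ◁ UF i2 ◁ UF i1, x ◁ UF i2).

(** This lets [F_1] be pulled out of the sum defining [nabla_mul], so the first component follows
    from the second. *)
Lemma in_S5_MF x y : in_S5 a x -> x * (y ◁ UF i1) = (x * y) ◁ UF i1.
Proof. by move=> /in_S5P[xK xK' xE xF]; rewrite actFM xF xK' mul0r add0r. Qed.

(** The surviving Leibniz term carries [q^(N/2)], from the inverse of [K_2] acting on entries of
    degree [-N]; with the prefactor [q^-N] this leaves [q^(-N/2)]. *)
Lemma nabla_mulE N x : in_L a N x -> nabla_mul a N x = dbar_twisted N x.
Proof.
move=> xN.
pose S := \sum_(p : 'I_(`|N|.+1) * 'I_(`|N|.+1) * 'I_(`|N|.+1)
          | (p.1.1 + p.1.2 + p.2 == `|N|)%N)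
    psi_star q N p.1.1 p.1.2 p.2 * ((qadj (psi_star q N p.1.1 p.1.2 p.2) * x) ◁ UF i2).
have SE : S = qhalf q N *: (x ◁ UF i2).
  have := psi_F2 N; set A := (A in A = 0 -> _) => A0.
  have := psi_unit q_gt0 q_lt1 N; set B := (B in B = 1 -> _) => B1.
  transitivity (qhalf q N *: (A * x + B * (x ◁ UF i2))).
    rewrite !mulr_suml -big_split scaler_sumr.
    apply: eq_bigr => p /eqP jkl /=.
    rewrite (in_L_F2M (in_L_qadj (psi_star_in_L jkl)) xN) opprK mulrDr.
    by rewrite -!scalerAr -scalerDr !mulrA.
  by rewrite A0 B1 mul0r add0r mul1r.
have -> : nabla_mul a N x = qpow q (- N) *: (S ◁ UF i1, S).
  congr (_ *: _); rewrite /S.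
  rewrite (big_morph (fun x => x ◁ UF i1) (fun x y => actDl a x y _) (act0l a _)).
  rewrite -sum_pair; apply: eq_bigr => p /eqP jkl.
  rewrite /delbar /psi -[star (psi_star _ _ _ _ _)]/(qadj _) -[star _]/(qadj _).
  rewrite /= [qadj (qadj _)]qadjK actMr in_S5_MF //.
  by have [] := psi_star_in_L jkl.
rewrite SE actZl -(scale_pair _ (x ◁ UF i2 ◁ UF i1) (x ◁ UF i2)).
rewrite scalerA /dbar_twisted; congr (_ *: _).
by rewrite (qpow_qhalf q_gt0) -(qhalfD q_gt0) subrK.
Qed.

Lemma dbar_twistedD N x y :
  dbar_twisted N (x + y) = dbar_twisted N x + dbar_twisted N y.
Proof. by rewrite /dbar_twisted -scalerDr !actDl. Qed.

(** In the first term the weight [q^(M/2)] of [y] cancels the surplus normalisation. In the second,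
    one half of [q^-N] comes from the normalisation and the other from the inverse of [K_2] acting
    on [x]. As [x] and [y] are invariant, [F_1] reaches only the factor that [F_2] has hit. *)
Lemma dbar_twistedM N M x y : in_L a N x -> in_L a M y ->
  dbar_twisted (N + M) (x * y) =
  ((dbar_twisted N x).1 * y + qpow q (- N) *: (x * (dbar_twisted M y).1),
   (dbar_twisted N x).2 * y + qpow q (- N) *: (x * (dbar_twisted M y).2)).
Proof.
move=> xN yM.
have e1 : qhalf q (- (N + M)) * qhalf q M = qhalf q (- N).
  by rewrite -(qhalfD q_gt0) opprD subrK.
have e2 : qhalf q (- (N + M)) * qhalf q (- N) = qpow q (- N) * qhalf q (- M).
  by rewrite (qpow_qhalf q_gt0) -!(qhalfD q_gt0); congr qhalf; rewrite opprD addrAC.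
have S5 z N' : in_L a N' z -> [/\ z ◁ UK i1 = z, z ◁ UKinv i1 = z & z ◁ UF i1 = 0].
  by case=> /in_S5P[].
have [xK xK' xF] := S5 _ _ xN; have [yK yK' yF] := S5 _ _ yM.
rewrite /dbar_twisted (in_L_F2M xN yM) actDl !actZl !actFM xF yF xK' yK.
rewrite mulr0 mul0r add0r addr0.
have key (c d e f g : R[i]) (v w : SUq3 q) : c * d = e -> c * e = f * g ->
    c *: (d *: (v * y) + e *: (x * w)) = (e *: v) * y + f *: (x * (g *: w)).
  by move=> de fg; rewrite scalerDr !scalerA de fg -scalerAl -scalerAr scalerA.
exact: (congr2 pair (key _ _ _ _ _ _ _ e1 e2) (key _ _ _ _ _ _ _ e1 e2)).
Qed.

End Connection.

(** * The image of the multiplication maps *)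

Section TwistedForms.
Variables (R : realType) (q : R).
Hypotheses (q_gt0 : 0 < q) (q_lt1 : q < 1).
Variable a : Uq_action q.
Local Notation "x ◁ h" := (act a x h) (at level 40, left associativity).
Local Notation i1 := (ord0 : 'I_2).
Local Notation i2 := (ord_max : 'I_2).
Local Notation UK := (UK q).
Local Notation UE := (UE q).
Local Notation UF := (UF q).
Local Notation H := (UK i1 * UK i2 ^+ 2).

(* The image of [Omega ⊗ L_N] under multiplication. *)
Definition in_OmegaL (N : int) (w : SUq3 q * SUq3 q) : Prop :=
  [/\ w.1 ◁ H = (qhalf q 3 * qpow q N) *: w.1 /\
      w.2 ◁ H = (qhalf q 3 * qpow q N) *: w.2,
      w.1 ◁ UK i1 = qhalf q 1 *: w.1 /\ w.2 ◁ UK i1 = qhalf q (-1) *: w.2,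
      w.1 ◁ UF i1 = 0 /\ w.2 ◁ UF i1 = w.1 &
      w.1 ◁ UE i1 = w.2 /\ w.2 ◁ UE i1 = 0].

Lemma in_OmegaL0 w : in_OmegaL 0 w <-> in_Omega a w.
Proof. by rewrite /in_OmegaL qpow0 mulr1. Qed.

Lemma in_OmegaL_zero N : in_OmegaL N 0.
Proof. by split; rewrite /= !act0l ?scaler0. Qed.

Lemma in_OmegaLD N v w : in_OmegaL N v -> in_OmegaL N w -> in_OmegaL N (v + w).
Proof.
move=> [[v1 v2] [v3 v4] [v5 v6] [v7 v8]] [[w1 w2] [w3 w4] [w5 w6] [w7 w8]].
by split; rewrite /= !actDl ?scalerDr ?v1 ?v2 ?v3 ?v4 ?v5 ?v6 ?v7 ?v8
  ?w1 ?w2 ?w3 ?w4 ?w5 ?w6 ?w7 ?w8 ?addr0.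
Qed.

Lemma in_OmegaLZ N c w : in_OmegaL N w -> in_OmegaL N (c *: w).
Proof.
move=> [[w1 w2] [w3 w4] [w5 w6] [w7 w8]].
by split; rewrite /= !actZl ?w1 ?w2 ?w3 ?w4 ?w5 ?w6 ?w7 ?w8 ?scaler0 // !scalerA
  ![c * _]mulrC.
Qed.

Lemma in_OmegaL_mull N M x w : in_L a N x -> in_OmegaL M w ->
  in_OmegaL (N + M) (x * w.1, x * w.2).
Proof.
move=> [/in_S5P[xK xK' xE xF] xN] [[w1 w2] [w3 w4] [w5 w6] [w7 w8]].
rewrite /in_OmegaL qpowD // mulrCA.
split; rewrite /= ?actKKM ?actKM ?actEM ?actFM ?xK ?xK' ?xE ?xF ?mul0r ?add0r.
- by rewrite xN w1 w2 -!scalerAr -!scalerAl !scalerA mulrC.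
- by rewrite w3 w4 -!scalerAr.
- by rewrite w5 w6 mulr0.
- by rewrite w7 w8 mulr0.
Qed.

Lemma in_OmegaL_mulr N M x w : in_OmegaL N w -> in_L a M x ->
  in_OmegaL (N + M) (w.1 * x, w.2 * x).
Proof.
move=> [[w1 w2] [w3 w4] [w5 w6] [w7 w8]] [/in_S5P[xK xK' xE xF] xN].
rewrite /in_OmegaL qpowD // mulrA.
split; rewrite /= ?actKKM ?actKM ?actEM ?actFM ?xK ?xK' ?xE ?xF ?mulr0 ?addr0.
- by rewrite xN w1 w2 -!scalerAr -!scalerAl !scalerA mulrC.
- by rewrite w3 w4 -!scalerAl.
- by rewrite w5 w6 mul0r.
- by rewrite w7 w8 mul0r.
Qed.

Lemma actBr x h k : x ◁ (h - k) = x ◁ h - x ◁ k.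
Proof. by rewrite actDr -[- k]scaleN1r actZr scaleN1r. Qed.

(** The vectors [u = x ◁ F_2] and [u ◁ F_1] form a doublet: [u ◁ E_1 = 0] because [E_1] and [F_2]
    commute, [u ◁ F_1 F_1 = 0] by the Serre relation and [x ◁ F_1 = 0], and [u ◁ F_1 E_1 = u] by the
    commutator of [E_1] and [F_1] at weight [q^(-1/2)]. *)
Lemma dbar_twisted_in N x : in_L a N x -> in_OmegaL N (dbar_twisted a N x).
Proof.
move=> /(in_LP q_gt0)[/in_S5P[xK xK' xE xF] xN]; apply: in_OmegaLZ.
set u := x ◁ UF i2.
have uK1 : u ◁ UK i1 = qhalf q (-1) *: u.
  by rewrite -actMr (@UFK_neq _ _ q_gt0 i1 i2) // actZr actMr xK.
have uK2 : u ◁ UK i2 = (qpow q 1 * qhalf q N) *: u.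
  by rewrite -actMr UFK // actZr actMr xN actZl scalerA.
have vK1 : u ◁ UF i1 ◁ UK i1 = (qpow q 1 * qhalf q (-1)) *: (u ◁ UF i1).
  by rewrite -actMr UFK // actZr actMr uK1 actZl scalerA.
have vK2 : u ◁ UF i1 ◁ UK i2 = (qhalf q (-1) * (qpow q 1 * qhalf q N)) *: (u ◁ UF i1).
  by rewrite -actMr (@UFK_neq _ _ q_gt0 i2 i1) // actZr actMr uK2 actZl scalerA.
have uE : u ◁ UE i1 = 0.
  by rewrite -actMr -UEF_neq // actMr xE act0l.
have HE y c d : y ◁ UK i1 = c *: y -> y ◁ UK i2 = d *: y -> y ◁ H = (c * d * d) *: y.
  by move=> yc yd; rewrite expr2 !actMr yc !actZl yd actZl yd !scalerA.
split; rewrite /=; split.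
- rewrite (HE _ _ _ vK1 vK2); congr (_ *: _).
  rewrite !(qpow_qhalf q_gt0) -!(qhalfD q_gt0); congr qhalf; ring.
- rewrite (HE _ _ _ uK1 uK2); congr (_ *: _).
  rewrite !(qpow_qhalf q_gt0) -!(qhalfD q_gt0); congr qhalf; ring.
- by rewrite vK1 (qpow_qhalf q_gt0) -(qhalfD q_gt0).
- exact: uK1.
- have := congr1 (act a x) (@UF_serre _ _ q_gt0 i1 i2 isT).
  by rewrite actDr actZr !actMr xF !act0l !scaler0 addr0.
- by [].
- have := congr1 (act a u) (UEF q i1).
  rewrite actBr actZr actBr !actMr uE act0l sub0r uK1 (weight_Kinv q_gt0 uK1).
  rewrite !actZl uK1 (weight_Kinv q_gt0 uK1) => /(congr1 -%R); rewrite opprK => ->.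
  rewrite !scalerA -!(qhalfD q_gt0) -scalerBl scalerA -scaleNr -[RHS]scale1r.
  rewrite -!(qpow_qhalf q_gt0) opprK; congr (_ *: _).
  (* A zero denominator would make [qint q 1] zero, against [qint_gt0]. *)
  have : qpow q 1 - qpow q (-1) != 0.
    apply: contraTneq (qint_gt0 q_gt0 q_lt1 0) => e.
    by rewrite /qint [X in _ / X]e invr0 mulr0 ltxx.
  by move: (qpow q 1) (qpow q (-1)) => c d cd; field.
- exact: uE.
Qed.

Lemma unit_decomposition N : exists s : seq (L a (- N) * L a N),
  \sum_(p <- s) Lval p.1 * Lval p.2 = 1.
Proof.
rewrite -(psi_unit q_gt0 q_lt1 (- N)).
elim: (index_enum _) => [|p r [s sE]]; first by exists [::]; rewrite !big_nil.
rewrite big_cons; case: eqP => [jkl|_]; last by exists s.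
have p1 := psi_star_in_L q_gt0 a jkl; have := in_L_qadj q_gt0 p1.
rewrite opprK => p2; exists ((toL p1, toL p2) :: s).
by rewrite big_cons sE.
Qed.

End TwistedForms.

(** * Multiplication maps on tensor products *)

Lemma additive0 (V W : zmodType) (f : V -> W) : {morph f : x y / x + y} -> f 0 = 0.
Proof. by move=> fD; apply: (addrI (f 0)); rewrite -fD !addr0. Qed.

Lemma additiveN (V W : zmodType) (f : V -> W) : {morph f : x y / x + y} ->
  {morph f : x / - x}.
Proof.
by move=> fD x; apply: (addrI (f x)); rewrite -fD !subrr additive0.
Qed.

Section TensorWithL.
Variables (R : realType) (q : R).
Hypotheses (q_gt0 : 0 < q) (q_lt1 : q < 1).
Variable a : Uq_action q.
Local Notation A := (SUq3 q).
Local Notation LL N := (L_bimodule a N).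
Local Notation OO := (Omega_bimodule a).

Let q0 : q != 0. Proof. exact: lt0r_neq0. Qed.

Definition mulrp (w : A * A) (y : A) : A * A := (w.1 * y, w.2 * y).

Lemma mulrpDl v w y : mulrp (v + w) y = mulrp v y + mulrp w y.
Proof. by rewrite /mulrp !mulrDl. Qed.

Lemma mulrpDr w x y : mulrp w (x + y) = mulrp w x + mulrp w y.
Proof. by rewrite /mulrp !mulrDr. Qed.

Lemma mulrpA w x y : mulrp (mulrp w x) y = mulrp w (x * y).
Proof. by rewrite /mulrp /= !mulrA. Qed.

Lemma mulrpZ c w y : mulrp (c *: w) y = c *: mulrp w y.
Proof. by rewrite /mulrp /= -!scalerAl. Qed.

Lemma mulrp1 w : mulrp w 1 = w.
Proof. by case: w => w1 w2; rewrite /mulrp !mulr1. Qed.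

Lemma in_LMN N x y : in_L a N x -> in_L a (- N) y -> in_L a 0 (x * y).
Proof. by move=> xN yN; rewrite -(subrr N); exact: in_LM. Qed.

Lemma Lval_sum N (I : Type) (r : seq I) (f : I -> LL N) :
  Lval (\sum_(i <- r) f i) = \sum_(i <- r) Lval (f i).
Proof. by elim: r => [|i r IH]; rewrite ?big_nil // !big_cons -IH. Qed.

Section MulMap.
Variables (U : bimodule (CP2 a)) (m : U -> A * A).
Hypothesis mD : {morph m : u v / u + v}.
Hypothesis m_inj : injective m.
Hypothesis mr : forall u b, m (ract u b) = mulrp (m u) (Lval b).
Variable N : int.

(** Kept generic in [m] because it is used twice: for the inclusion of [Omega], and for
    [mul_Omega_L] on [Omega ⊗ L_N]. *)
Definition mul_right : U ⊗ LL N -> A * A :=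
  tlift (U := U) (V := LL N) (fun u x => mulrp (m u) (Lval x)).

Lemma mul_right_pure u x : mul_right (pure u x) = mulrp (m u) (Lval x).
Proof.
apply: (tlift_pure (f := fun (u : U) (x : LL N) => mulrp (m u) (Lval x))).
split=> [v w y|v y y'|v b y].
- by rewrite mD mulrpDl.
- by rewrite -mulrpDr.
- by rewrite mr mulrpA.
Qed.

Lemma mul_rightD : {morph mul_right : s t / s + t}.
Proof. exact: tliftD. Qed.

(* With [1 = \sum p.1 p.2], [p.1 : L_(-N)], [p.2 : L_N], every tensor [t] is
   [\sum (mul_right t * p.1) ⊗ p.2], hence is determined by [mul_right t]. *)
Lemma mul_right_inj : injective mul_right.
Proof.
have [s s1] := unit_decomposition q_gt0 q_lt1 a N.
pose b (x : LL N) (p : L a (- N) * L a N) : CP2 a :=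
  toL (in_LMN (L_in x) (L_in p.1)).
pose G p : U ⊗ LL N -> U := tlift (fun (u : U) (x : LL N) => ract u (b x p)).
have G_pure p u x : G p (pure u x) = ract u (b x p).
  apply: (tlift_pure (f := fun (u : U) (x : LL N) => ract u (b x p))).
  split=> [v w y|v y y'|v c y].
  - by rewrite ractDl.
  - by rewrite -ractDr; congr ract; apply: val_inj; rewrite /= mulrDl.
  - by rewrite -ractM; congr ract; apply: val_inj; rewrite /= mulrA.
have GD p : {morph G p : t t' / t + t'} by exact: tliftD.
have mG p t : m (G p t) = mulrp (mul_right t) (Lval p.1).
  move: t; apply: additive_eq => [t t'|t t'|u x].
  - by rewrite GD mD.
  - by rewrite mul_rightD mulrpDl.
  - by rewrite G_pure mr mul_right_pure mulrpA.
have tE t : t = \sum_(p <- s) pure (G p t) (p.2 : LL N).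
  move: t; apply: (additive_eq (h := id)) => [//|t t'|u x].
    by rewrite -big_split; apply: eq_bigr => p _; rewrite GD pureDl.
  transitivity (pure u (\sum_(p <- s) lact (b x p) (p.2 : LL N))).
    congr pure; apply: val_inj.
    rewrite -[RHS]/(Lval _) Lval_sum -[LHS]mulr1 -s1 mulr_sumr; apply: eq_bigr => p _.
    by rewrite /= mulrA.
  rewrite (big_morph (pure u) (pureDr u) (additive0 (pureDr u))).
  by apply: eq_bigr => p _; rewrite G_pure pure_balanced.
move=> t t' tt'; rewrite (tE t) (tE t'); apply: eq_bigr => p _.
by congr pure; apply: m_inj; rewrite !mG tt'.
Qed.

Lemma mul_right_ract t b : mul_right (ract t b) = mulrp (mul_right t) (Lval b).
Proof.
move: t; apply: (additive_eq (h := fun t => mul_right (tensor_ract t b))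
  (k := fun t => mulrp (mul_right t) (Lval b))) => [t t'|t t'|u x].
- by rewrite tensor_ractDl mul_rightD.
- by rewrite mul_rightD mulrpDl.
- by rewrite tensor_ractE !mul_right_pure mulrpA.
Qed.

End MulMap.
End TensorWithL.

(** * Comparison of the connections inside A(SU_q(3))^2 *)

Section TensorConnection.
Variables (R : realType) (q : R).
Hypotheses (q_gt0 : 0 < q) (q_lt1 : q < 1).
Variable a : Uq_action q.
Local Notation A := (SUq3 q).
Local Notation LL N := (L_bimodule a N).
Local Notation OO := (Omega_bimodule a).

Let Omega_valD : {morph (@Omega_val R q a : OO -> A * A) : v w / v + w}.
Proof. by []. Qed.

Let Omega_val_r (v : OO) (b : CP2 a) : Omega_val (ract v b) = mulrp (Omega_val v) (Lval b).
Proof. by []. Qed.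

Lemma mul_Omega_L_inj N : injective (@mul_Omega_L R q a N).
Proof. exact: (mul_right_inj q_gt0 q_lt1 Omega_valD val_inj Omega_val_r). Qed.

Lemma mul_Omega_LD N : {morph @mul_Omega_L R q a N : s t / s + t}.
Proof. exact: tliftD. Qed.

Lemma mul_Omega_L_ract N (t : OO ⊗ LL N) b :
  mul_Omega_L (ract t b) = mulrp (mul_Omega_L t) (Lval b).
Proof. exact: (mul_right_ract Omega_valD Omega_val_r). Qed.

(** Right multiplication by the factors in [L_(-N)] of a decomposition of 1 brings [w] into [Omega];
    the factors in [L_N] bring it back. This excludes the default value 0 in [nabla] and [sigma]. *)
Lemma mul_Omega_L_surj N w : in_OmegaL a N w ->
  exists t : OO ⊗ LL N, mul_Omega_L t = w.
Proof.
move=> wN; have [s s1] := unit_decomposition q_gt0 q_lt1 a N.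
have wO (p : L a (- N) * L a N) : in_Omega a (mulrp w (Lval p.1)).
  apply/in_OmegaL0; rewrite -(subrr N); apply: in_OmegaL_mulr => //.
  exact: L_in.
exists (\sum_(p <- s) pure (toOmega (wO p) : OO) (p.2 : LL N)).
rewrite (big_morph _ (@mul_Omega_LD N) (additive0 (@mul_Omega_LD N))).
rewrite -[RHS]mulrp1 -s1.
rewrite (big_morph (mulrp w) (mulrpDr w) (additive0 (mulrpDr w))).
by apply: eq_bigr => p _; rewrite mul_Omega_L_pure -mulrpA.
Qed.

Lemma mul_Omega_L_nabla N (x : LL N) :
  mul_Omega_L (nabla a N x) = dbar_twisted a N (Lval x).
Proof.
rewrite /nabla; case: classical_sets.xgetP => [t _ ->|no].
  by rewrite nabla_mulE //; exact: L_in.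
have [t tE] := mul_Omega_L_surj (dbar_twisted_in q_gt0 q_lt1 (L_in x)).
by case: (no t); rewrite /= tE nabla_mulE //; exact: L_in.
Qed.

Lemma phi1E N (t : OO ⊗ LL N) : phi1 t = qhalf q N *: mul_Omega_L t.
Proof.
move: t; apply: additive_eq => [|s t|v x]; first exact: tliftD.
- by rewrite mul_Omega_LD scalerDr.
- by rewrite phi1_pure mul_Omega_L_pure.
Qed.

Lemma phi2D N : {morph @phi2 R q a N : s t / s + t}.
Proof. exact: tliftD. Qed.

Lemma phi2_in N (t : LL N ⊗ OO) : in_OmegaL a N (phi2 t).
Proof.
elim/tensor_ind: t => [|x v|s t|t].
- by rewrite (additive0 (@phi2D N)); exact: in_OmegaL_zero.
- rewrite phi2_pure; apply: in_OmegaLZ.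
  have vO := (in_OmegaL0 _ _).2 (Omega_in v).
  by have := in_OmegaL_mull q_gt0 (L_in x) vO; rewrite addr0.
- by rewrite phi2D; exact: in_OmegaLD.
- by rewrite (additiveN (@phi2D N)) -scaleN1r; exact: in_OmegaLZ.
Qed.

Lemma mul_Omega_L_sigma N (t : LL N ⊗ OO) :
  mul_Omega_L (sigma a N t) = qhalf q (- N) *: phi2 t.
Proof.
rewrite /sigma; case: classical_sets.xgetP => [s _ <-|no].
  by rewrite phi1E scalerA -(qhalfD q_gt0) addNr qhalf0 scale1r.
have [s sE] := mul_Omega_L_surj (in_OmegaLZ (qhalf q (- N)) (phi2_in t)).
by case: (no s); rewrite /= phi1E sE scalerA -(qhalfD q_gt0) subrr qhalf0 scale1r.
Qed.

Lemma mul_Omega_L_sigma_pure N (x : LL N) (v : OO) :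
  mul_Omega_L (sigma a N (pure x v)) =
  qpow q (- N) *: (Lval x * v.1, Lval x * v.2).
Proof.
have -> : qpow q (- N) = qhalf q (- N) * qhalf q (- N).
  by rewrite (qpow_qhalf q_gt0) (qhalfD q_gt0).
by rewrite mul_Omega_L_sigma phi2_pure scalerA.
Qed.

(** Together with [sigma_ract], this is what makes [sigma ⊗ 1] well defined on tensors over
    [CP2]. *)
Lemma sigmaD N : {morph sigma a N : s t / s + t}.
Proof.
move=> s t; apply: mul_Omega_L_inj.
by rewrite mul_Omega_LD !mul_Omega_L_sigma phi2D scalerDr.
Qed.

Lemma phi2_ract N (t : LL N ⊗ OO) b : phi2 (ract t b) = mulrp (phi2 t) (Lval b).
Proof.
move: t; apply: (additive_eq (h := fun t => phi2 (tensor_ract t b))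
  (k := fun t => mulrp (phi2 t) (Lval b))) => [s t|s t|x v].
- by rewrite tensor_ractDl phi2D.
- by rewrite phi2D mulrpDl.
- rewrite tensor_ractE !phi2_pure mulrpZ; congr (_ *: _).
  by rewrite /mulrp /= !mulrA.
Qed.

Lemma sigma_ract N (t : LL N ⊗ OO) b : sigma a N (ract t b) = ract (sigma a N t) b.
Proof.
apply: mul_Omega_L_inj; rewrite mul_Omega_L_ract !mul_Omega_L_sigma phi2_ract.
by rewrite mulrpZ.
Qed.

Section Mul3.
Variables N M : int.

Definition mul_Omega_LL : (OO ⊗ LL N) ⊗ LL M -> A * A :=
  mul_right (U := OO ⊗ LL N) (@mul_Omega_L R q a N) (N := M).

Lemma mul_Omega_LL_pure (u : OO ⊗ LL N) (y : LL M) :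
  mul_Omega_LL (pure (U := OO ⊗ LL N) u y) = mulrp (mul_Omega_L u) (Lval y).
Proof. exact: (mul_right_pure (@mul_Omega_LD N) (@mul_Omega_L_ract N)). Qed.

Lemma mul_Omega_LLD : {morph mul_Omega_LL : s t / s + t}.
Proof. exact: tliftD. Qed.

Lemma mul_Omega_LL_inj : injective mul_Omega_LL.
Proof.
exact: (mul_right_inj q_gt0 q_lt1 (@mul_Omega_LD N) (@mul_Omega_L_inj N)
  (@mul_Omega_L_ract N)).
Qed.

(** Stated for arbitrary [s] because it is applied to [nabla y], which need not be a pure tensor. *)
Lemma mul_Omega_LL_sigma (x : LL N) (s : OO ⊗ LL M) :
  mul_Omega_LL (tmap (U := LL N ⊗ OO) (U' := OO ⊗ LL N) (@sigma R q a N)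
    (@id (LL M)) (tassocl (pure (V := OO ⊗ LL M) x s))) =
  qpow q (- N) *: (Lval x * (mul_Omega_L s).1, Lval x * (mul_Omega_L s).2).
Proof.
move: s; apply: (additive_eq (h := fun s => mul_Omega_LL (tmap (U := LL N ⊗ OO)
  (U' := OO ⊗ LL N) (@sigma R q a N)
    (@id (LL M)) (tassocl (pure (V := OO ⊗ LL M) x s))))
  (k := fun s => qpow q (- N) *: (Lval x * (mul_Omega_L s).1, Lval x * (mul_Omega_L s).2)))
  => [s t|s t|v y].
- by rewrite pureDr /tassocl tliftD /tmap tliftD mul_Omega_LLD.
- by rewrite mul_Omega_LD /= !mulrDr -scalerDr.
- rewrite tassocl_pure tmap_pure //; first last.
  + exact: sigma_ract.
  + exact: sigmaD.
  rewrite mul_Omega_LL_pure mul_Omega_L_sigma_pure mul_Omega_L_pure mulrpZ.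
  by rewrite /mulrp /= !mulrA.
Qed.

Lemma mul_Omega_LL_connection (x : LL N) (y : LL M) :
  mul_Omega_LL (tensor_connection_pure a N M x y) =
  dbar_twisted a (N + M) (Lval x * Lval y).
Proof.
rewrite /tensor_connection_pure mul_Omega_LLD mul_Omega_LL_sigma mul_Omega_LL_pure.
by rewrite !mul_Omega_L_nabla (dbar_twistedM q_gt0 (L_in x) (L_in y)).
Qed.

(** After the injective map [mul_Omega_LL] the value depends on [x] and [y] only through their
    product, so balancedness becomes associativity. *)
Lemma tensor_connection_balanced : balanced (tensor_connection_pure a N M).
Proof.
split=> [x x' y|x y y'|x b y]; apply: mul_Omega_LL_inj.
- by rewrite [RHS]mul_Omega_LLD !mul_Omega_LL_connection -dbar_twistedD -mulrDl.
- by rewrite [RHS]mul_Omega_LLD !mul_Omega_LL_connection -dbar_twistedD -mulrDr.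
- by rewrite !mul_Omega_LL_connection /= mulrA.
Qed.

(** Both sides are the total product on pure tensors. The last goal of the proof, left linearity of
    [mulL], is what [tmap_pure] needs. *)
Lemma mul_Omega_L_mul_last (q0 : q != 0) (t : (OO ⊗ LL N) ⊗ LL M) :
  mul_Omega_L (mul_last a q0 N M t) = mul_Omega_LL t.
Proof.
have lastD : {morph mul_last a q0 N M : s t / s + t}.
  by move=> s s'; rewrite /mul_last /tassocr tliftD /tmap tliftD.
move: t; apply: (additive_eq (h := fun t => mul_Omega_L (mul_last a q0 N M t)))
  => [s t|s t|u y].
- by rewrite lastD mul_Omega_LD.
- exact: mul_Omega_LLD.
move: u; apply: (additive_eq
  (h := fun u => mul_Omega_L (mul_last a q0 N M (pure (U := OO ⊗ LL N) u y)))
  (k := fun u => mul_Omega_LL (pure (U := OO ⊗ LL N) u y))) => [u u'|u u'|v x].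
- by rewrite pureDl lastD mul_Omega_LD.
- by rewrite pureDl mul_Omega_LLD.
rewrite mul_Omega_LL_pure mul_Omega_L_pure /mul_last tassocr_pure.
rewrite (tmap_pure (V := LL N ⊗ LL M)) //.
- by rewrite mul_Omega_L_pure mulL_pure /mulrp /= !mulrA.
- exact: tliftD.
move=> b; apply: (additive_eq (h := fun t => mulL a q0 N M (tensor_lact b t))
  (k := fun t => lact b (mulL a q0 N M t) : LL (N + M))) => [s t|s t|x' y'].
- by rewrite tensor_lactDr /mulL tliftD.
- by rewrite [X in lact _ X]tliftD lactDr.
- by apply: val_inj; rewrite tensor_lactE /= !mulL_pure /= mulrA.
Qed.

End Mul3.
End TensorConnection.

(** The first clause certifies that [tensor_connection] is the intended map and not the default zero
    of [tlift]; it is balancedness. The second is an identity between additive maps, checked on pure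
    tensors after the injective [mul_Omega_L]. *)
Theorem proposition4p4 (R : realType) (q : R) (q_gt0 : 0 < q) (q_lt1 : q < 1)
    (a : Uq_action q) (N M : int) :
  (forall (x : L_bimodule a N) (y : L_bimodule a M),
     tensor_connection a N M (pure x y) =
       pure (U := Omega_bimodule a ⊗ L_bimodule a N) (nabla a N x) y
       + tmap (U := L_bimodule a N ⊗ Omega_bimodule a)
              (U' := Omega_bimodule a ⊗ L_bimodule a N)
              (sigma a N) (@id (L_bimodule a M))
              (tassocl (pure (V := Omega_bimodule a ⊗ L_bimodule a M)
                             x (nabla a M y))))
  /\ (forall t : L_bimodule a N ⊗ L_bimodule a M,
        mul_last a (lt0r_neq0 q_gt0) N M (tensor_connection a N M t) =
          nabla a (N + M) (mulL a (lt0r_neq0 q_gt0) N M t)).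
Proof.
have conn_pure := tlift_pure (tensor_connection_balanced q_gt0 q_lt1 a N M).
split=> [x y|t]; first exact: conn_pure.
apply: (mul_Omega_L_inj q_gt0 q_lt1); rewrite mul_Omega_L_mul_last mul_Omega_L_nabla //.
move: t; apply: (additive_eq
  (h := fun t => mul_Omega_LL (tensor_connection a N M t))
  (k := fun t => dbar_twisted a (N + M) (Lval (mulL a (lt0r_neq0 q_gt0) N M t))))
  => [s t|s t|x y].
- by rewrite /tensor_connection tliftD mul_Omega_LLD.
- by rewrite /mulL tliftD -dbar_twistedD.
- by rewrite [tensor_connection _ _ _ _]conn_pure mul_Omega_LL_connection // mulL_pure.
Qed.
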